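(* There exists one and only one solution $(\rho,u)$ over the interval $[\sigma_\ell,\sigma_p]$ of the system $$\rho'(x)=-\frac{2u(x)\,(u(x)-x)}{x\bigl((u(x)-x)^2-c(x)^2\bigr)}\,\rho(x),\qquad u'(x)=\frac{2c(x)^2}{x\bigl((u(x)-x)^2-c(x)^2\bigr)}\,u(x),$$ with $\rho(\sigma_p)=\rho_1$ and $u(\sigma_p)=u_1$.
   Context: Data: real numbers $\gamma_u>1$, $\rho_0>0$, $p_0>0$; $c_0=(\gamma_u p_0/\rho_0)^{1/2}$; a precursor shock speed $\sigma_p>c_0$, with $M_p=\sigma_p/c_0>1$. The state $(\rho_1,u_1,p_1)$ behind the precursor shock is $$\rho_1=\frac{\gamma_u+1}{\gamma_u-1+2/M_p^2}\,\rho_0,\quad u_1=\Bigl(1-\frac{\rho_0}{\rho_1}\Bigr)\sigma_p,\quad p_1=p_0+\Bigl(1-\frac{\rho_0}{\rho_1}\Bigr)\rho_0\,\sigma_p^2,$$ and $s_1=p_1/\rho_1^{\gamma_u}$. Given a function $\rho\ge 0$, $c(x)\ge 0$ is defined by $c(x)^2=\gamma_u s_1\,\rho(x)^{\gamma_u-1}$. For $\sigma\in[0,\sigma_p)$, a solution on $[\sigma,\sigma_p]$ is a pair $(\rho,u)$ of real functions, continuous on $[\sigma,\sigma_p]$ and continuously differentiable at all $x>0$ of this interval, with $\rho\ge0$, such that $(u(x)-x)^2-c(x)^2\ne 0$ and the two differential equations of the system hold at each $x>0$ in $[\sigma,\sigma_p]$, and such that $\rho(\sigma_p)=\rho_1$,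 $u(\sigma_p)=u_1$. $\sigma_\ell$ is the smallest real number (infimum) of the set of $\sigma\in[0,\sigma_p)$ for which there is a solution on $[\sigma,\sigma_p]$ satisfying $0\le u(x)\le x$ and $\rho(x)\ge 0$ for all $x\in[\sigma,\sigma_p]$. *)

(* Defs.v *)
From Stdlib Require Import Reals.
From Coquelicot Require Import Coquelicot.
Open Scope R_scope.

(** Real power of a nonnegative base.  [Rpower] cannot be used directly because
    [Rpower 0 a = 1]; here [rpow 0 a = 0], the right value for an exponent
    [a > 0] (only exponents [gamma_u] and [gamma_u - 1] occur). *)
Definition rpow (x a : R) : R := if Req_EM_T x 0 then 0 else Rpower x a.

Definition c0 (gamma_u rho0 p0 : R) : R := sqrt (gamma_u * p0 / rho0).

Definition Mp (gamma_u rho0 p0 sigma_p : R) : R :=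
  sigma_p / c0 gamma_u rho0 p0.

Definition rho1 (gamma_u rho0 p0 sigma_p : R) : R :=
  (gamma_u + 1) / (gamma_u - 1 + 2 / Mp gamma_u rho0 p0 sigma_p ^ 2) * rho0.

Definition u1 (gamma_u rho0 p0 sigma_p : R) : R :=
  (1 - rho0 / rho1 gamma_u rho0 p0 sigma_p) * sigma_p.

Definition p1 (gamma_u rho0 p0 sigma_p : R) : R :=
  p0 + (1 - rho0 / rho1 gamma_u rho0 p0 sigma_p) * rho0 * sigma_p ^ 2.

Definition s1 (gamma_u rho0 p0 sigma_p : R) : R :=
  p1 gamma_u rho0 p0 sigma_p / rpow (rho1 gamma_u rho0 p0 sigma_p) gamma_u.

(** Local sound speed as a function of the density [r >= 0]. *)
Definition sound (gamma_u rho0 p0 sigma_p r : R) : R :=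
  sqrt (gamma_u * s1 gamma_u rho0 p0 sigma_p * rpow r (gamma_u - 1)).

Definition Icc (a b x : R) : Prop := a <= x <= b.

Definition Icc_pos (a b x : R) : Prop := Icc a b x /\ 0 < x.

(** [D_in f d D x] is the derivative relative to the set [D], hence one-sided
    at the endpoints of an interval: values of [f] outside [[a, b]] are
    irrelevant here and below. *)
Definition C1_pos (f : R -> R) (a b : R) : Prop :=
  exists d : R -> R,
    (forall x, Icc_pos a b x -> D_in f d (Icc a b) x) /\
    continuous_on (Icc_pos a b) d.

Definition solution (gamma_u rho0 p0 sigma_p sigma : R) (rho u : R -> R)
  : Prop :=
  let c x := sound gamma_u rho0 p0 sigma_p (rho x) in
  0 <= sigma < sigma_p /\
  continuous_on (Icc sigma sigma_p) rho /\
  continuous_on (Icc sigma sigma_p) u /\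
  C1_pos rho sigma sigma_p /\
  C1_pos u sigma sigma_p /\
  (forall x, Icc sigma sigma_p x -> 0 <= rho x) /\
  (forall x, Icc_pos sigma sigma_p x ->
     (u x - x) ^ 2 - c x ^ 2 <> 0 /\
     D_in rho
       (fun y => - (2 * u y * (u y - y)) / (y * ((u y - y) ^ 2 - c y ^ 2))
                 * rho y)
       (Icc sigma sigma_p) x /\
     D_in u
       (fun y => 2 * c y ^ 2 / (y * ((u y - y) ^ 2 - c y ^ 2)) * u y)
       (Icc sigma sigma_p) x) /\
  rho sigma_p = rho1 gamma_u rho0 p0 sigma_p /\
  u sigma_p = u1 gamma_u rho0 p0 sigma_p.

Definition admissible (gamma_u rho0 p0 sigma_p sigma : R) : Prop :=
  0 <= sigma < sigma_p /\
  exists rho u : R -> R,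
    solution gamma_u rho0 p0 sigma_p sigma rho u /\
    forall x, Icc sigma sigma_p x -> 0 <= u x <= x /\ 0 <= rho x.

(** The set is bounded below by [0], so its infimum is a real number as soon as
    it is nonempty. *)
Definition sigma_l (gamma_u rho0 p0 sigma_p : R) : R :=
  real (Glb_Rbar (admissible gamma_u rho0 p0 sigma_p)).

(* Main.v *)
Require Import Defs.
From Stdlib Require Import Reals Lra Lia.
From Coquelicot Require Import Coquelicot.
Open Scope R_scope.

(** The density enters the system only through [q = c ^ 2], a constant times
    [rho] to the power [gamma_u - 1], so the unknowns may be taken to be [u]
    and [q].  With [v = x - u] the system reads
    [u' = - 2 u / (x (1 - v ^ 2 / q))] and
    [q' = - 2 (gamma_u - 1) u v / (x (1 - v ^ 2 / q))].

    The shock relations make the state at [sigma_p] subsonic: [v ^ 2 < q]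
    ([shock_facts]).  A solution is not allowed to cross [v ^ 2 = q], so it
    stays subsonic, and then [u] and [rho] stay positive because each satisfies
    a homogeneous linear equation.  Going left from [sigma_p], [u] increases
    and [v] decreases; as long as [v >= 0], [q] increases too.  Hence the state
    stays in the region where [v] lies between [0] and its value [v_1] at
    [sigma_p] and [q] is at least its value [q_1] there ([trapped]), and in that
    region [1 - v ^ 2 / q >= 1 - v_1 ^ 2 / q_1 > 0].  Clamping [x], [u], [v]
    and [q] to this region turns the right-hand side into a globally Lipschitz
    one, for which Picard iteration gives a solution [(U, Q)] on the whole of
    [[u_1, sigma_p]] and a Gronwall estimate gives uniqueness.

    Since [U] is at least [u_1] and increases to the left while the diagonal
    decreases, the graph of [U] meets the diagonal at a point [tau], and
    [(U, Q)] solves the original system on [[tau, sigma_p]]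
    ([exists_maximal_flow]).  A solution with [u <= x] on [[a, sigma_p]] agrees
    with [(U, Q)] to the right of both [a] and [tau].  If [a < tau] it would
    have [u tau = tau], and [u] increases to the left, so [u a >= tau > a], a
    contradiction: thus [tau] is [sigma_l]
    ([trapped_flow_starts_after_maximal]).  Finally, a solution on
    [[sigma_l, sigma_p]] automatically satisfies [u <= x]
    ([flow_on_maximal_interval_trapped]), hence is [(U, Q)]. *)

(** * Clamping, and uniform limits in normed modules *)

Definition clamp (a b t : R) : R := Rmax a (Rmin b t).

Lemma clamp_bounds (a b t : R) : a <= b -> a <= clamp a b t <= b.
Proof. intros; unfold clamp, Rmax, Rmin; repeat destruct Rle_dec; lra. Qed.

Lemma clamp_id (a b t : R) : a <= t <= b -> clamp a b t = t.
Proof. intros; unfold clamp, Rmax, Rmin; repeat destruct Rle_dec; lra. Qed.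

Lemma clamp_lipschitz (a b s t : R) :
  Rabs (clamp a b s - clamp a b t) <= Rabs (s - t).
Proof.
  unfold clamp, Rmax, Rmin, Rabs.
  repeat destruct Rle_dec; repeat destruct Rcase_abs; lra.
Qed.

Lemma continuous_lipschitz (f : R -> R) (x : R) :
  (forall y, Rabs (f y - f x) <= Rabs (y - x)) -> continuous f x.
Proof.
  intros H. apply filterlim_locally. intros eps. exists eps. intros y Hy.
  apply Rle_lt_trans with (2 := Hy). apply H.
Qed.

Lemma Rmax_lipschitz (a x y : R) : Rabs (Rmax a x - Rmax a y) <= Rabs (x - y).
Proof.
  unfold Rmax, Rabs. repeat destruct Rle_dec; repeat destruct Rcase_abs; lra.
Qed.

Lemma clamp_continuous (a b t : R) : continuous (clamp a b) t.
Proof. apply continuous_lipschitz; intros; apply clamp_lipschitz. Qed.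

Lemma minus_eq_0 {G : AbelianGroup} (x y : G) : minus x y = zero -> x = y.
Proof.
  intros h.
  transitivity (plus (minus x y) y).
  - transitivity (plus x (plus (opp y) y)); [|apply plus_assoc].
    transitivity (plus x zero); [symmetry; apply plus_zero_r|].
    f_equal. symmetry. apply plus_opp_l.
  - rewrite h. apply plus_zero_l.
Qed.

Lemma minus_cancel_l {G : AbelianGroup} (x y z : G) :
  minus (minus x y) (minus x z) = minus z y.
Proof.
  transitivity (plus (minus x y) (minus z x)).
  - unfold minus at 1. f_equal. apply opp_minus.
  - rewrite (minus_trans x z y). apply plus_comm.
Qed.

Lemma dist_triangle {W : CompleteNormedModule R_AbsRing} (y x z : W) :
  norm (minus x z) <= norm (minus x y) + norm (minus y z).
Proof. rewrite (minus_trans y x z). apply (@norm_triangle _ W). Qed.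

Lemma dist_sym {W : CompleteNormedModule R_AbsRing} (x y : W) :
  norm (minus x y) = norm (minus y x).
Proof. rewrite <- (opp_minus y x). apply (@norm_opp _ W). Qed.

Lemma continuous_norm {V : CompleteNormedModule R_AbsRing} (f : R -> V) (x : R) :
  continuous f x -> continuous (fun t => norm (f t)) x.
Proof.
  intros H. apply (continuous_comp f norm); [easy|]. apply (@filterlim_norm _ V).
Qed.

Lemma half_pow_small (B eps : R) : 0 <= B -> 0 < eps ->
  exists N, forall n, (N <= n)%nat -> B * (/ 2) ^ n < eps.
Proof.
  intros HB He.
  destruct (pow_lt_1_zero (/ 2)) with (y := eps / (B + 1)) as [N HN].
  - rewrite Rabs_pos_eq; lra.
  - apply Rdiv_lt_0_compat; lra.
  - exists N. intros n Hn. specialize (HN n Hn).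
    assert (Hp : 0 < (/ 2) ^ n) by (apply pow_lt; lra).
    rewrite Rabs_pos_eq in HN by lra.
    apply Rlt_div_r in HN; [|lra]. nra.
Qed.

Lemma uniform_limit_continuous {V : CompleteNormedModule R_AbsRing}
  (f : nat -> R -> V) (Y : R -> V) :
  (forall n t, continuous (f n) t) ->
  (forall eps : R, 0 < eps ->
    exists n, forall m t, (n <= m)%nat -> norm (minus (f m t) (Y t)) < eps) ->
  forall t, continuous Y t.
Proof.
  intros Hc H t. apply (proj2 (@filterlim_locally_ball_norm _ _ V _ _ Y (Y t))).
  intros [eps He]. destruct (H (eps / 3)) as [n Hn]; [lra|].
  assert (Hf := proj1 (@filterlim_locally_ball_norm _ _ V _ _ (f n) (f n t)) (Hc n t)).
  assert (He3 : 0 < eps / 3) by lra.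
  specialize (Hf (mkposreal _ He3)).
  revert Hf. apply filter_imp. intros s Hs.
  unfold ball_norm in *. simpl in *.
  assert (h1 := Rle_lt_trans _ _ _ (Req_le _ _ (dist_sym (Y s) (f n s)))
    (Hn n s (le_n n))).
  assert (h2 := Hn n t (le_n n)).
  assert (h3 := dist_triangle (f n s) (Y s) (Y t)).
  assert (h4 := dist_triangle (f n t) (f n s) (Y t)).
  eapply Rle_lt_trans; [exact h3|].
  apply Rlt_le_trans with (eps / 3 + (eps / 3 + eps / 3)); [|lra].
  apply Rplus_lt_compat; [easy|].
  eapply Rle_lt_trans; [exact h4|]. now apply Rplus_lt_compat.
Qed.

Lemma continuous_pair {T U W : UniformSpace} (f : T -> U) (g : T -> W) (x : T) :
  continuous f x -> continuous g x -> continuous (fun t => (f t, g t)) x.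
Proof.
  intros Hf Hg. apply filterlim_locally. intros eps.
  generalize (filter_and _ _ (proj1 (filterlim_locally _ _) Hf eps)
    (proj1 (filterlim_locally _ _) Hg eps)).
  apply filter_imp. now intros y [h1 h2].
Qed.

(** * Picard iteration *)

Section Picard.
Context {V : CompleteNormedModule R_AbsRing}.
Context (F : R -> V -> V) (L a b : R) (y0 : V) (HL : 0 < L) (Hab : a <= b)
  (F_continuous : forall y : R -> V, (forall t, continuous y t) ->
    forall t, continuous (fun s => F s (y s)) t)
  (F_lipschitz : forall t p p',
    norm (minus (F t p) (F t p')) <= L * norm (minus p p')).

(** The supremum norm weighted by this function makes the Picard operator a
    contraction of ratio [1/2] on the whole interval at once, whatever its
    length. *)
Let weight (t : R) : R := exp (2 * L * (b - t)).

(** The initial time is the right endpoint [b], hence the minus sign. *)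
Definition picard_map (y : R -> V) (t : R) : V :=
  minus y0 (RInt (fun s => F s (y s)) t b).

(** Freezing the time outside [[a, b]] makes estimates on [[a, b]] hold
    uniformly on the whole line, so that the limit can be taken in the complete
    space of functions on the line with uniform convergence. *)
Let step (y : R -> V) (t : R) : V := picard_map y (clamp a b t).

Lemma picard_map_derive (y : R -> V) (t : R) :
  (forall s, continuous y s) -> is_derive (picard_map y) t (F t (y t)).
Proof.
  intros Hy. unfold picard_map.
  assert (H : is_derive (fun s => RInt (fun s => F s (y s)) s b) t
    (opp (F t (y t)))).
  { apply (is_derive_RInt' (fun s => F s (y s)) _ t b).
    - apply filter_forall. intros s. apply (RInt_correct (V:=V)).
      apply (ex_RInt_continuous (V:=V)). intros z _. now apply F_continuous.
    - now apply F_continuous. }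
  assert (H' := is_derive_minus (fun _ => y0) _ t _ _ (is_derive_const y0 t) H).
  replace (F t (y t)) with (minus (zero : V) (opp (F t (y t)))).
  exact H'.
  unfold minus. rewrite opp_opp. apply plus_zero_l.
Qed.

Lemma step_continuous (y : R -> V) :
  (forall s, continuous y s) -> forall t, continuous (step y) t.
Proof.
  intros Hy t. unfold step. apply (continuous_comp (clamp a b) (picard_map y)).
  - apply clamp_continuous.
  - apply (ex_derive_continuous (picard_map y)). eexists. now apply picard_map_derive.
Qed.

(** The integral of [2 L weight] over [[t, b]] is [weight t - weight b], which
    is at most [weight t]. *)
Lemma step_contracts (y z : R -> V) (A : R) :
  (forall s, continuous y s) -> (forall s, continuous z s) ->
  (forall t, a <= t <= b -> norm (minus (y t) (z t)) <= A * weight t) ->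
  forall t, a <= t <= b ->
    norm (minus (step y t) (step z t)) <= A / 2 * weight t.
Proof.
  intros Hy Hz H t Ht. unfold step, picard_map. rewrite (clamp_id a b t Ht).
  set (f := fun s => F s (y s)). set (g := fun s => F s (z s)).
  assert (Hf : ex_RInt f t b).
  { apply (ex_RInt_continuous (V:=V)). intros w _. now apply F_continuous. }
  assert (Hg : ex_RInt g t b).
  { apply (ex_RInt_continuous (V:=V)). intros w _. now apply F_continuous. }
  replace (minus (minus y0 (RInt f t b)) (minus y0 (RInt g t b)))
    with (minus (RInt g t b) (RInt f t b)).
  2:{ symmetry. apply minus_cancel_l. }
  assert (HA : 0 <= A).
  { assert (0 <= A * weight t) by (apply Rle_trans with (2 := H t Ht), norm_ge_0).
    assert (0 < weight t) by apply exp_pos. nra. }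
  apply Rle_trans with (A / 2 * weight t - A / 2 * weight b).
  2:{ assert (0 < weight b) by apply exp_pos. nra. }
  apply (norm_RInt_le (fun s => minus (g s) (f s))
    (fun s => L * (A * weight s)) t b).
  - lra.
  - intros s Hs. unfold f, g. eapply Rle_trans; [apply F_lipschitz|].
    apply Rmult_le_compat_l; [lra|].
    eapply Rle_trans; [apply Req_le, dist_sym|]. apply H. lra.
  - apply (is_RInt_minus (V:=V)); now apply (RInt_correct (V:=V)).
  - replace (A / 2 * weight t - A / 2 * weight b) with
      (minus (- (A / 2) * weight b) (- (A / 2) * weight t)).
    2:{ unfold minus, plus, opp; simpl; ring. }
    apply (is_RInt_derive (fun s => - (A / 2) * weight s)).
    + intros s _. unfold weight. auto_derive; [easy|]. unfold Rminus. field.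
    + intros s _. unfold weight.
      apply (ex_derive_continuous (V:=R_NormedModule)). auto_derive. easy.
Qed.

Fixpoint iterate (n : nat) : R -> V :=
  match n with O => fun _ => y0 | S n => step (iterate n) end.

Lemma iterate_continuous (n : nat) : forall t, continuous (iterate n) t.
Proof.
  induction n; simpl.
  - intros t. apply continuous_const.
  - now apply step_continuous.
Qed.

Lemma iterate_clamp (n : nat) (t : R) : iterate n t = iterate n (clamp a b t).
Proof.
  destruct n; simpl; [easy|]. unfold step.
  now rewrite (clamp_id a b (clamp a b t)) by now apply clamp_bounds.
Qed.

Lemma weight_bounds (t : R) : a <= t <= b -> 1 <= weight t <= weight a.
Proof.
  intros Ht. unfold weight. rewrite <- exp_0 at 1.
  assert (Hm : forall x y, x <= y -> exp x <= exp y).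
  { intros x y [h|h]; [left; now apply exp_increasing | right; now f_equal]. }
  split; apply Hm; nra.
Qed.

Lemma iterate_step_bound : exists B, 0 <= B /\ forall n t,
  norm (minus (iterate (S n) t) (iterate n t)) <= B * (/ 2) ^ n.
Proof.
  destruct (continuity_ab_maj
    (fun t => norm (minus (iterate 1 t) (iterate 0 t))) a b Hab) as [m [Hm _]].
  { intros t _. apply continuity_pt_filterlim.
    apply (continuous_norm (fun t => minus (iterate 1 t) (iterate 0 t))).
    apply (continuous_minus (V:=V)); apply iterate_continuous. }
  set (A := norm (minus (iterate 1 m) (iterate 0 m))) in *.
  assert (HA : 0 <= A) by apply norm_ge_0.
  assert (Hw : forall n t, a <= t <= b ->
    norm (minus (iterate (S n) t) (iterate n t)) <= A * (/ 2) ^ n * weight t).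
  { induction n; intros t Ht.
    - eapply Rle_trans; [now apply Hm|]. simpl.
      destruct (weight_bounds t Ht). nra.
    - replace (A * (/ 2) ^ S n) with (A * (/ 2) ^ n / 2) by (simpl; field).
      change (iterate (S (S n))) with (step (iterate (S n))).
      change (iterate (S n) t) with (step (iterate n) t).
      apply step_contracts;
        [apply (iterate_continuous (S n)) | apply iterate_continuous | exact IHn | easy]. }
  exists (A * weight a). split.
  { destruct (weight_bounds a); [lra|]. nra. }
  intros n t. rewrite (iterate_clamp (S n)), (iterate_clamp n).
  assert (Hc := clamp_bounds a b t Hab).
  eapply Rle_trans; [now apply Hw|].
  destruct (weight_bounds (clamp a b t) Hc).
  assert (0 < (/ 2) ^ n) by (apply pow_lt; lra).
  replace (A * weight a * (/ 2) ^ n) with (A * (/ 2) ^ n * weight a) by ring.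
  apply Rmult_le_compat_l; [nra | lra].
Qed.

(** Sum of a geometric series. *)
Lemma iterate_cauchy : exists B, 0 <= B /\ forall n k t,
  norm (minus (iterate (n + k) t) (iterate n t)) <= B * (/ 2) ^ n.
Proof.
  destruct iterate_step_bound as [B [HB H]]. exists (2 * B). split; [lra|].
  assert (H' : forall k n t, norm (minus (iterate (n + k) t) (iterate n t))
    <= 2 * B * (/ 2) ^ n * (1 - (/ 2) ^ k)).
  { induction k; intros n t.
    - rewrite Nat.add_0_r, minus_eq_zero. simpl.
      eapply Rle_trans; [apply Req_le, (@norm_zero _ V)|]. lra.
    - replace (n + S k)%nat with (S n + k)%nat by lia.
      eapply Rle_trans; [apply (dist_triangle (iterate (S n) t))|].
      eapply Rle_trans; [apply Rplus_le_compat; [apply IHk | apply H]|].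
      apply Req_le. simpl. field. }
  intros n k t. eapply Rle_trans; [apply H'|].
  assert (0 < (/ 2) ^ n) by (apply pow_lt; lra).
  assert (0 < (/ 2) ^ k) by (apply pow_lt; lra).
  assert (0 <= B * (/ 2) ^ n) by nra.
  rewrite <- (Rmult_1_r (2 * B * (/ 2) ^ n)) at 2.
  apply Rmult_le_compat_l; lra.
Qed.

Lemma iterate_limit : exists Y : R -> V, forall eps : R, 0 < eps ->
  exists n, forall m t, (n <= m)%nat -> norm (minus (iterate m t) (Y t)) < eps.
Proof.
  destruct iterate_cauchy as [B [HB H]].
  destruct (proj1 (filterlim_locally_cauchy (T:=nat)
    (U := fct_CompleteSpace (T:=R) (U:=V)) (F:=eventually) iterate)) as [Y HY].
  - intros [eps He]. destruct (half_pow_small B (eps/2) HB) as [N HN]; [lra|].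
    exists (fun n => (N <= n)%nat). split; [now exists N|].
    assert (HNn : forall n t, (N <= n)%nat ->
      norm (minus (iterate n t) (iterate N t)) < eps / 2).
    { intros n t Hn. replace n with (N + (n - N))%nat by lia.
      eapply Rle_lt_trans; [apply H | now apply HN]. }
    intros n m Hn Hm t. apply (@norm_compat1 _ V). simpl.
    eapply Rle_lt_trans; [apply (dist_triangle (iterate N t))|].
    assert (h1 := HNn n t Hn). assert (h2 := HNn m t Hm).
    apply Rlt_le_trans with (eps / 2 + eps / 2); [|lra].
    apply Rplus_lt_compat; [exact h2|].
    eapply Rle_lt_trans; [apply Req_le, dist_sym | exact h1].
  - exists Y. intros eps He.
    assert (Hf : 0 < norm_factor (V := V)) by apply (@norm_factor_gt_0 _ V).
    assert (He' : 0 < eps / norm_factor (V := V)) by now apply Rdiv_lt_0_compat.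
    destruct (proj1 (filterlim_locally _ _) HY (mkposreal _ He')) as [N HN].
    exists N. intros m t Hm. specialize (HN m Hm t).
    apply (@norm_compat2 _ V) in HN. simpl in HN.
    replace (norm_factor * (eps / norm_factor)) with eps in HN by (field; lra).
    exact HN.
Qed.

(** The uniform limit [Y] of the iterates is a fixed point of the clamped
    operator.  The solution is the unclamped image of [Y]: it coincides with [Y]
    on [[a, b]] and is differentiable on both sides at the endpoints. *)
Theorem picard_lindelof : exists y : R -> V,
  y b = y0 /\ forall t, a <= t <= b -> is_derive y t (F t (y t)).
Proof.
  destruct iterate_limit as [Y HY].
  assert (Yc : forall t, continuous Y t)
    by exact (uniform_limit_continuous _ _ iterate_continuous HY).
  assert (fix_Y : forall t, a <= t <= b -> step Y t = Y t).
  { intros t Ht.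
    apply minus_eq_0, (@norm_eq_zero _ V). apply Rle_antisym; [|apply norm_ge_0].
    apply Rnot_lt_le. intros Hpos.
    set (e := norm (minus (step Y t) (Y t))) in *.
    assert (Hw := weight_bounds t Ht).
    assert (He : 0 < e / (1 + weight a)) by (apply Rdiv_lt_0_compat; lra).
    set (d := e / (1 + weight a)) in *.
    destruct (HY d He) as [n Hn].
    assert (h1 := Hn (S n) t (Nat.le_succ_diag_r n)).
    assert (h2 : norm (minus (step Y t) (iterate (S n) t)) <= d / 2 * weight t).
    { apply (step_contracts Y (iterate n)); try easy; [apply iterate_continuous|].
      intros s Hs. eapply Rle_trans; [apply Req_le, dist_sym|].
      assert (h := Hn n s (le_n n)). assert (Hws := weight_bounds s Hs). nra. }
    assert (h3 : e <= d / 2 * weight t + d).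
    { unfold e. eapply Rle_trans; [apply (dist_triangle (iterate (S n) t))|].
      apply Rplus_le_compat; [exact h2 | now left]. }
    assert (h4 : e = d * (1 + weight a)) by (unfold d; field; lra).
    nra. }
  exists (picard_map Y).
  assert (HYp : forall t, a <= t <= b -> picard_map Y t = Y t).
  { intros t Ht. rewrite <- (fix_Y t Ht). unfold step. now rewrite clamp_id. }
  split.
  - unfold picard_map. rewrite RInt_point. apply (@minus_zero_r V).
  - intros t Ht. rewrite (HYp t Ht). now apply picard_map_derive.
Qed.
End Picard.


(** * Scalar differential inequalities *)

Lemma is_derive_eq (f : R -> R) (x l l' : R) :
  is_derive f x l -> l = l' -> is_derive f x l'.
Proof. now intros H <-. Qed.

(** Replaces the derivatives that [auto_derive] leaves unevaluated, matching
    them up to eta-expansion. *)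
Ltac use_derive H :=
  match type of H with
  | is_derive _ ?x ?l =>
      match goal with
      | |- context [Derive ?g x] =>
          replace (Derive g x) with l by (symmetry; apply is_derive_unique; exact H)
      end
  end.

(** The derivative is only required inside the interval, because the solutions
    considered below have one-sided derivatives at the endpoints. *)
Lemma nondecreasing_from_derivative (f df : R -> R) (a b : R) : a <= b ->
  (forall x, a <= x <= b -> continuous f x) ->
  (forall x, a < x < b -> is_derive f x (df x)) ->
  (forall x, a < x < b -> 0 <= df x) -> f a <= f b.
Proof.
  intros Hab Hc Hd Hp.
  (* The mean value theorem may return an endpoint, where nothing is known about
     the sign of [df]; the truncated derivative is nonnegative everywhere. *)
  destruct (MVT_gen f a b (fun x => Rmax 0 (df x))) as [c [_ Hc2]].
  - intros x Hx. rewrite Rmin_left, Rmax_right in Hx by lra.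
    rewrite Rmax_right by now apply Hp. now apply Hd.
  - intros x Hx. rewrite Rmin_left, Rmax_right in Hx by lra.
    now apply continuity_pt_filterlim, Hc.
  - assert (0 <= Rmax 0 (df c)) by apply Rmax_l. nra.
Qed.

Lemma nonincreasing_from_derivative (f df : R -> R) (a c : R) : a <= c ->
  (forall x, a <= x <= c -> continuous f x) ->
  (forall x, a < x < c -> is_derive f x (df x)) ->
  (forall x, a < x < c -> df x <= 0) -> f c <= f a.
Proof.
  intros Hac Hc Hd Hp.
  assert (h : - f a <= - f c); [|lra].
  apply (nondecreasing_from_derivative (fun x => - f x) (fun x => - df x)); [easy | | |].
  - intros x Hx. apply (continuous_opp (V:=R_NormedModule) f). auto.
  - intros x Hx. apply (is_derive_opp f). auto.
  - intros x Hx. specialize (Hp x Hx). lra.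
Qed.

(** [f x * exp (C * x)] is nondecreasing. *)
Lemma backward_gronwall (f df : R -> R) (C a b : R) : a <= b ->
  (forall x, a <= x <= b -> continuous f x) ->
  (forall x, a < x < b -> is_derive f x (df x)) ->
  (forall x, a < x < b -> - C * f x <= df x) -> f b <= 0 -> f a <= 0.
Proof.
  intros Hab Hc Hd Hp Hb.
  assert (H : f a * exp (C * a) <= f b * exp (C * b)).
  { apply (nondecreasing_from_derivative (fun x => f x * exp (C * x))
      (fun x => (df x + C * f x) * exp (C * x))); [easy | | |].
    - intros x Hx. apply (continuous_mult f); [now apply Hc|].
      apply (ex_derive_continuous (V:=R_NormedModule)). auto_derive. easy.
    - intros x Hx. specialize (Hd x Hx). auto_derive.
      + eexists; eassumption.
      + use_derive Hd. ring.
    - intros x Hx. specialize (Hp x Hx). assert (h := exp_pos (C * x)). nra. }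
  assert (h := exp_pos (C * a)). assert (h' := exp_pos (C * b)). nra.
Qed.

(** [f * exp (- K)], where [K] is a primitive of [k], is constant. *)
Lemma linear_ode_positive (f k : R -> R) (a b : R) :
  (forall x, continuous k x) ->
  (forall x, a <= x <= b -> continuous f x) ->
  (forall x, a < x < b -> is_derive f x (k x * f x)) ->
  0 < f b -> forall x, a <= x <= b -> 0 < f x.
Proof.
  intros Hk Hc Hd Hb x Hx.
  set (K := fun t => RInt k b t).
  assert (HK : forall t, is_derive K t (k t)).
  { intros t. apply (is_derive_RInt k K b t); [|apply Hk].
    apply filter_forall. intros s. apply (RInt_correct (V:=R_CompleteNormedModule)).
    apply (ex_RInt_continuous (V:=R_CompleteNormedModule)). intros; apply Hk. }
  assert (Hm : forall s,
    s * (f x * exp (- K x)) <= s * (f b * exp (- K b))).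
  { intros s.
    apply (nondecreasing_from_derivative (fun t => s * (f t * exp (- K t)))
      (fun _ => 0)); [lra | | |].
    - intros t Ht. apply (continuous_mult (fun _ => s)); [apply continuous_const|].
      apply (continuous_mult f); [apply Hc; lra|].
      apply (continuous_comp (fun t => - K t) exp).
      + apply (continuous_opp K). apply (ex_derive_continuous K). eexists; apply HK.
      + apply (ex_derive_continuous (V:=R_NormedModule)). auto_derive. easy.
    - intros t Ht. assert (Hd' : is_derive f t (k t * f t)) by (apply Hd; lra).
      specialize (HK t). auto_derive.
      + repeat (match goal with |- _ /\ _ => split end); eexists; eassumption.
      + use_derive Hd'. use_derive HK. ring.
    - intros; lra. }
  assert (H1 := Hm 1). assert (H2 := Hm (-1)).
  assert (h := exp_pos (- K x)). assert (h' := exp_pos (- K b)).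
  assert (0 < f b * exp (- K b)) by nra.
  assert (f x * exp (- K x) = f b * exp (- K b)) by lra. nra.
Qed.

Lemma ivt (f : R -> R) (a b y : R) : a <= b ->
  (forall x, a <= x <= b -> continuous f x) ->
  f a <= y <= f b \/ f b <= y <= f a -> exists x, a <= x <= b /\ f x = y.
Proof.
  intros Hab Hc Hy.
  destruct (IVT_gen_consistent (fun x => f (clamp a b x)) a b y) as [x [_ Hx]].
  - intros x. apply (continuous_comp (clamp a b) f).
    + apply clamp_continuous.
    + apply Hc. now apply clamp_bounds.
  - rewrite !clamp_id by lra. unfold Rmin, Rmax; repeat destruct Rle_dec; lra.
  - exists (clamp a b x). split; [now apply clamp_bounds | easy].
Qed.

(** * Planar Lipschitz systems *)

(** A field [f t u q] that is Lipschitz in [(u, q)].  Its continuity is stated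
    along continuous curves, which is what Picard iteration uses and what
    composes without discussion of the topology of a product. *)
Definition lipschitz_field (f : R -> R -> R -> R) : Prop :=
  (exists L, 0 <= L /\ forall t u q u' q',
    Rabs (f t u q - f t u' q') <= L * (Rabs (u - u') + Rabs (q - q'))) /\
  (forall u q : R -> R,
    (forall t, continuous u t) -> (forall t, continuous q t) ->
    forall t, continuous (fun s => f s (u s) (q s)) t).

Definition bounded_field (f : R -> R -> R -> R) : Prop :=
  exists M, forall t u q, Rabs (f t u q) <= M.

Lemma lipschitz_const (c : R) : lipschitz_field (fun _ _ _ => c).
Proof.
  split.
  - exists 0. split; [lra|]. intros. rewrite Rminus_diag, Rabs_R0. lra.
  - intros. apply continuous_const.
Qed.

Lemma bounded_const (c : R) : bounded_field (fun _ _ _ => c).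
Proof. exists (Rabs c). intros; lra. Qed.

Lemma lipschitz_u : lipschitz_field (fun _ u _ => u).
Proof.
  split; [|easy]. exists 1. split; [lra|]. intros.
  assert (h := Rabs_pos (q - q')). lra.
Qed.

Lemma lipschitz_q : lipschitz_field (fun _ _ q => q).
Proof.
  split; [|easy]. exists 1. split; [lra|]. intros.
  assert (h := Rabs_pos (u - u')). lra.
Qed.

Lemma lipschitz_t : lipschitz_field (fun t _ _ => t).
Proof.
  split.
  - exists 0. split; [lra|]. intros. rewrite Rminus_diag, Rabs_R0. lra.
  - intros. apply continuous_id.
Qed.

Lemma lipschitz_v : lipschitz_field (fun t u _ => t - u).
Proof.
  split.
  - exists 1. split; [lra|]. intros t u q u' q'.
    replace (t - u - (t - u')) with (- (u - u')) by ring. rewrite Rabs_Ropp.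
    assert (h := Rabs_pos (q - q')). lra.
  - intros u q Hu Hq t. apply (continuous_minus (V:=R_NormedModule) (fun t => t));
      [apply continuous_id | apply Hu].
Qed.

Lemma lipschitz_mult (f g : R -> R -> R -> R) :
  lipschitz_field f -> bounded_field f -> lipschitz_field g -> bounded_field g ->
  lipschitz_field (fun t u q => f t u q * g t u q).
Proof.
  intros [[Lf [HLf Hf]] Cf] [Mf Bf] [[Lg [HLg Hg]] Cg] [Mg Bg]. split.
  - assert (HMf : 0 <= Mf) by (eapply Rle_trans; [apply Rabs_pos | apply (Bf 0 0 0)]).
    assert (HMg : 0 <= Mg) by (eapply Rle_trans; [apply Rabs_pos | apply (Bg 0 0 0)]).
    exists (Lf * Mg + Mf * Lg). split; [nra|]. intros t u q u' q'.
    replace (f t u q * g t u q - f t u' q' * g t u' q') with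
      ((f t u q - f t u' q') * g t u q + f t u' q' * (g t u q - g t u' q')) by ring.
    eapply Rle_trans; [apply Rabs_triang|]. rewrite !Rabs_mult.
    set (d := Rabs (u - u') + Rabs (q - q')).
    assert (h1 := Hf t u q u' q'). assert (h2 := Hg t u q u' q').
    assert (h3 := Bf t u' q'). assert (h4 := Bg t u q).
    fold d in h1, h2.
    replace ((Lf * Mg + Mf * Lg) * d) with (Lf * d * Mg + Mf * (Lg * d)) by ring.
    apply Rplus_le_compat; apply Rmult_le_compat; try apply Rabs_pos; easy.
  - intros u q Hu Hq t. apply (continuous_mult (fun s => f s (u s) (q s))); auto.
Qed.

Lemma bounded_mult (f g : R -> R -> R -> R) :
  bounded_field f -> bounded_field g ->
  bounded_field (fun t u q => f t u q * g t u q).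
Proof.
  intros [Mf Bf] [Mg Bg]. exists (Mf * Mg). intros.
  rewrite Rabs_mult. apply Rmult_le_compat; auto using Rabs_pos.
Qed.

Lemma lipschitz_inv (f : R -> R -> R -> R) (m : R) : 0 < m ->
  (forall t u q, m <= f t u q) -> lipschitz_field f ->
  lipschitz_field (fun t u q => / f t u q).
Proof.
  intros Hm Hf [[L [HL H]] C]. split.
  - exists (L * (/ m * / m)).
    assert (0 < / m) by now apply Rinv_0_lt_compat.
    split; [nra|]. intros t u q u' q'.
    assert (h1 := Hf t u q). assert (h2 := Hf t u' q').
    replace (/ f t u q - / f t u' q') with
      (- (f t u q - f t u' q') * (/ f t u q * / f t u' q')) by (field; lra).
    rewrite Rabs_mult, Rabs_Ropp, (Rabs_pos_eq (_ * _)).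
    2:{ apply Rmult_le_pos; left; apply Rinv_0_lt_compat; lra. }
    replace (L * (/ m * / m) * (Rabs (u - u') + Rabs (q - q'))) with
      (L * (Rabs (u - u') + Rabs (q - q')) * (/ m * / m)) by ring.
    assert (forall x, m <= x -> 0 <= / x <= / m).
    { intros x Hx. split; [left; apply Rinv_0_lt_compat; lra|].
      now apply Rinv_le_contravar. }
    apply Rmult_le_compat; [apply Rabs_pos | | apply H |].
    + apply Rmult_le_pos; now apply H1.
    + apply Rmult_le_compat; now apply H1.
  - intros u q Hu Hq t.
    apply (continuous_comp (fun s => f s (u s) (q s)) Rinv); [auto|].
    assert (h := Hf t (u t) (q t)).
    apply (ex_derive_continuous (V:=R_NormedModule)). auto_derive. lra.
Qed.

Lemma bounded_inv (f : R -> R -> R -> R) (m : R) : 0 < m ->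
  (forall t u q, m <= f t u q) -> bounded_field (fun t u q => / f t u q).
Proof.
  intros Hm Hf. exists (/ m). intros t u q. specialize (Hf t u q).
  rewrite Rabs_pos_eq; [now apply Rinv_le_contravar|].
  left; apply Rinv_0_lt_compat; lra.
Qed.

Lemma lipschitz_comp (phi : R -> R) (f : R -> R -> R -> R) :
  (forall x y, Rabs (phi x - phi y) <= Rabs (x - y)) ->
  lipschitz_field f -> lipschitz_field (fun t u q => phi (f t u q)).
Proof.
  intros Hphi [[L [HL H]] C]. split.
  - exists L. split; [easy|]. intros. eapply Rle_trans; [apply Hphi | apply H].
  - intros u q Hu Hq t. apply (continuous_comp (fun s => f s (u s) (q s)) phi); [auto|].
    apply continuous_lipschitz. auto.
Qed.

Lemma bounded_clamp (f : R -> R -> R -> R) (a b : R) : a <= b ->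
  bounded_field (fun t u q => clamp a b (f t u q)).
Proof.
  intros Hab. exists (Rmax (Rabs a) (Rabs b)). intros t u q.
  assert (h := clamp_bounds a b (f t u q) Hab).
  unfold Rmax, Rabs. repeat destruct Rcase_abs; destruct Rle_dec; lra.
Qed.

(** The plane is viewed as the complex numbers, a complete normed module over
    the reals. *)
Lemma planar_existence (A B : R -> R -> R -> R) (a b u0 q0 : R) : a <= b ->
  lipschitz_field A -> lipschitz_field B ->
  exists u q : R -> R, u b = u0 /\ q b = q0 /\ forall t, a <= t <= b ->
    is_derive u t (A t (u t) (q t)) /\ is_derive q t (B t (u t) (q t)).
Proof.
  intros Hab [[LA [HLA HA]] CA] [[LB [HLB HB]] CB].
  set (V := C_R_CompleteNormedModule).
  (* The factor [4] bounds [sqrt 2] times [2], from the comparison of the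
     Euclidean norm with the maximum and of the sum with the maximum; adding [1]
     makes the constant positive. *)
  destruct (picard_lindelof (V:=V)
    (fun t p => (A t (fst p) (snd p), B t (fst p) (snd p)))
    (4 * (LA + LB + 1)) a b (u0, q0)) as [y [Hyb Hy]]; [lra | easy | | |].
  - intros y Hy t.
    assert (h1 : forall t, continuous (fun s => fst (y s)) t).
    { intros s. apply (continuous_comp y fst); [apply Hy|].
      destruct (y s). apply continuous_fst. }
    assert (h2 : forall t, continuous (fun s => snd (y s)) t).
    { intros s. apply (continuous_comp y snd); [apply Hy|].
      destruct (y s). apply continuous_snd. }
    apply (continuous_pair (fun s => A s (fst (y s)) (snd (y s)))
      (fun s => B s (fst (y s)) (snd (y s)))).
    + exact (CA _ _ h1 h2 t).
    + exact (CB _ _ h1 h2 t).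
  - intros t [u q] [u' q'].
    destruct (norm_prod (U:=R_NormedModule) (V:=R_NormedModule)
      (A t u q - A t u' q') (B t u q - B t u' q')) as [_ h1].
    destruct (norm_prod (U:=R_NormedModule) (V:=R_NormedModule) (u - u') (q - q'))
      as [h2 _].
    eapply Rle_trans; [exact h1|]. eapply Rle_trans.
    2:{ apply Rmult_le_compat_l; [lra | exact h2]. }
    unfold norm; simpl; unfold abs; simpl.
    assert (h3 := HA t u q u' q'). assert (h4 := HB t u q u' q').
    set (d := Rmax (Rabs (u - u')) (Rabs (q - q'))).
    assert (h5 : Rabs (u - u') <= d) by apply Rmax_l.
    assert (h6 : Rabs (q - q') <= d) by apply Rmax_r.
    assert (h7 := Rabs_pos (u - u')).
    assert (hs : sqrt 2 <= 2).
    { rewrite <- (sqrt_pow2 2) at 2 by lra. apply sqrt_le_1_alt. lra. }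
    assert (hs' := sqrt_pos 2).
    assert (h8 : Rmax (Rabs (A t u q - A t u' q')) (Rabs (B t u q - B t u' q'))
      <= 2 * (LA + LB) * d).
    { apply Rmax_lub; nra. }
    assert (h9 := Rle_trans _ _ _ (Rabs_pos (A t u q - A t u' q'))
      (Rmax_l _ (Rabs (B t u q - B t u' q')))).
    nra.
  - exists (fun t => fst (y t)), (fun t => snd (y t)). rewrite Hyb.
    do 2 (split; [easy|]). intros t Ht. specialize (Hy t Ht). split.
    + apply (filterdiff_ext_lin _ _ _ (filterdiff_comp y fst _ _ Hy
        (filterdiff_linear _ is_linear_fst))). easy.
    + apply (filterdiff_ext_lin _ _ _ (filterdiff_comp y snd _ _ Hy
        (filterdiff_linear _ is_linear_snd))). easy.
Qed.

Lemma continuous_sqr (f : R -> R) (x : R) :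
  continuous f x -> continuous (fun t => f t ^ 2) x.
Proof.
  intros Hf. apply (continuous_comp f (fun y => y ^ 2)); [easy|].
  apply (ex_derive_continuous (V:=R_NormedModule)). now auto_derive.
Qed.

(** Gronwall's inequality for the squared distance of the two solutions. *)
Lemma planar_uniqueness (A B : R -> R -> R -> R) (a b : R) (u q u' q' : R -> R) :
  a <= b -> lipschitz_field A -> lipschitz_field B ->
  (forall t, a <= t <= b -> continuous u t /\ continuous q t) ->
  (forall t, a <= t <= b -> continuous u' t /\ continuous q' t) ->
  (forall t, a < t < b ->
    is_derive u t (A t (u t) (q t)) /\ is_derive q t (B t (u t) (q t))) ->
  (forall t, a < t < b ->
    is_derive u' t (A t (u' t) (q' t)) /\ is_derive q' t (B t (u' t) (q' t))) ->
  u b = u' b -> q b = q' b -> u a = u' a /\ q a = q' a.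
Proof.
  intros Hab [[LA [HLA HA]] _] [[LB [HLB HB]] _] Hc Hc' Hd Hd' Hu Hq.
  assert (H : (u a - u' a) ^ 2 + (q a - q' a) ^ 2 <= 0).
  { apply (backward_gronwall (fun t => (u t - u' t) ^ 2 + (q t - q' t) ^ 2)
      (fun t => 2 * (u t - u' t) * (A t (u t) (q t) - A t (u' t) (q' t))
        + 2 * (q t - q' t) * (B t (u t) (q t) - B t (u' t) (q' t)))
      (4 * (LA + LB)) a b Hab).
    - intros t Ht. destruct (Hc t Ht), (Hc' t Ht).
      apply (continuous_plus (V:=R_NormedModule)).
      + apply (continuous_sqr (fun t => u t - u' t)).
        now apply (continuous_minus (V:=R_NormedModule) u u').
      + apply (continuous_sqr (fun t => q t - q' t)).
        now apply (continuous_minus (V:=R_NormedModule) q q').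
    - intros t Ht. destruct (Hd t Ht) as [h1 h2], (Hd' t Ht) as [h3 h4].
      auto_derive;
        [repeat (match goal with |- _ /\ _ => split end); eexists; eassumption|].
      use_derive h1. use_derive h2. use_derive h3. use_derive h4. ring.
    - intros t Ht.
      assert (h1 := HA t (u t) (q t) (u' t) (q' t)).
      assert (h2 := HB t (u t) (q t) (u' t) (q' t)).
      revert h1 h2.
      generalize (A t (u t) (q t) - A t (u' t) (q' t))
        (B t (u t) (q t) - B t (u' t) (q' t)) (u t - u' t) (q t - q' t).
      intros da db du dq h1 h2.
      assert (Hk : forall L x d, 0 <= L -> Rabs d <= L * (Rabs du + Rabs dq) ->
        Rabs x <= Rabs du + Rabs dq -> - (4 * L * (du ^ 2 + dq ^ 2)) <= 2 * x * d).
      { intros L x d HL Hd0 Hx.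
        assert (Rabs (x * d) <= (Rabs du + Rabs dq) * (L * (Rabs du + Rabs dq))).
        { rewrite Rabs_mult. apply Rmult_le_compat; auto using Rabs_pos. }
        assert (- (x * d) <= Rabs (x * d)) by (rewrite <- Rabs_Ropp; apply Rle_abs).
        assert ((Rabs du + Rabs dq) ^ 2 <= 2 * (du ^ 2 + dq ^ 2)).
        { rewrite <- (pow2_abs du), <- (pow2_abs dq).
          assert (h := pow2_ge_0 (Rabs du - Rabs dq)). nra. }
        nra. }
      assert (h3 := Rabs_pos du). assert (h4 := Rabs_pos dq).
      assert (k1 := Hk LA du da HLA h1 ltac:(lra)).
      assert (k2 := Hk LB dq db HLB h2 ltac:(lra)). lra.
    - rewrite Hu, Hq. lra. }
  assert (h1 := pow2_ge_0 (u a - u' a)). assert (h2 := pow2_ge_0 (q a - q' a)).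
  split; apply Rminus_diag_uniq; apply Rsqr_0_uniq; unfold Rsqr; lra.
Qed.


(** * Subsonic flows *)

(** The right-hand sides of the system in the unknowns [u] and [q = c ^ 2], as
    functions of the state: [euler_u] is that of [u'], and [euler_q] is
    [(g - 1) * q * rho' / rho], since [q] is proportional to [rho] to the power
    [g - 1]. *)
Definition euler_u (t u q : R) : R := 2 * q / (t * ((u - t) ^ 2 - q)) * u.

Definition euler_q (g t u q : R) : R :=
  - (g - 1) * (2 * u * (u - t) / (t * ((u - t) ^ 2 - q))) * q.

Section Subsonic.
Context (g b w1 q1 : R) (Hg : 1 < g) (Hw1 : 0 < w1) (Hw1b : w1 < b)
  (Hsub : (b - w1) ^ 2 < q1).

(** The region of states that a solution with nonnegative relative speed
    [t - u] cannot leave when followed leftwards from the state [(w1, q1)] at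
    time [b]. *)
Record trapped (t u q : R) : Prop := {
  trapped_t : w1 <= t <= b;
  trapped_u : w1 <= u <= b;
  trapped_v : 0 <= t - u <= b - w1;
  trapped_q : q1 <= q }.

(** The common factor [u / (t (1 - (t - u) ^ 2 / q))] of both right-hand sides,
    after division of numerator and denominator by [q]; each quantity is
    clamped to its range in [trapped]. *)
Let clamped_rate (t u q : R) : R :=
  clamp w1 b u * (/ Rmax w1 t *
    / (1 - clamp 0 (b - w1) (t - u) * clamp 0 (b - w1) (t - u) * / Rmax q1 q)).

Definition clamped_u (t u q : R) : R := -2 * clamped_rate t u q.
Definition clamped_q (t u q : R) : R :=
  -2 * (g - 1) * (clamp 0 (b - w1) (t - u) * clamped_rate t u q).

Lemma q1_pos : 0 < q1.
Proof. assert (h := pow2_ge_0 (b - w1)). lra. Qed.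

(** The squared Mach number of a clamped state is at most that of the state at
    [b]. *)
Lemma mach_bound (t u q : R) :
  1 - (b - w1) ^ 2 * / q1 <=
  1 - clamp 0 (b - w1) (t - u) * clamp 0 (b - w1) (t - u) * / Rmax q1 q.
Proof.
  assert (h := q1_pos).
  assert (hv := clamp_bounds 0 (b - w1) (t - u) ltac:(lra)).
  assert (h2 : 0 < / Rmax q1 q <= / q1).
  { assert (h3 := Rmax_l q1 q). split.
    - apply Rinv_0_lt_compat; lra.
    - apply Rinv_le_contravar; lra. }
  apply Rplus_le_compat_l, Ropp_le_contravar.
  apply Rmult_le_compat; nra.
Qed.

Lemma mach_bound_pos : 0 < 1 - (b - w1) ^ 2 * / q1.
Proof.
  assert (h := q1_pos). apply Rlt_0_minus.
  apply (Rmult_lt_reg_r q1); [easy|].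
  rewrite Rmult_assoc, Rinv_l; lra.
Qed.

Lemma clamped_rate_pos (t u q : R) : 0 < clamped_rate t u q.
Proof.
  unfold clamped_rate. repeat apply Rmult_lt_0_compat.
  - assert (h := clamp_bounds w1 b u ltac:(lra)). lra.
  - apply Rinv_0_lt_compat. assert (h := Rmax_l w1 t). lra.
  - apply Rinv_0_lt_compat. assert (h := mach_bound t u q).
    assert (h' := mach_bound_pos). lra.
Qed.

Lemma clamped_v_regular :
  lipschitz_field (fun t u q => clamp 0 (b - w1) (t - u)) /\
  bounded_field (fun t u q => clamp 0 (b - w1) (t - u)).
Proof.
  split.
  - apply (lipschitz_comp (clamp 0 (b - w1))); [apply clamp_lipschitz | apply lipschitz_v].
  - apply (bounded_clamp (fun t u _ => t - u)). lra.
Qed.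

Lemma clamped_rate_regular : lipschitz_field clamped_rate /\ bounded_field clamped_rate.
Proof.
  assert (hq := q1_pos). assert (hm := mach_bound_pos).
  destruct clamped_v_regular as [Lv Bv].
  assert (Lu : lipschitz_field (fun t u q => clamp w1 b u)).
  { apply (lipschitz_comp (clamp w1 b)); [apply clamp_lipschitz | apply lipschitz_u]. }
  assert (Bu : bounded_field (fun t u q => clamp w1 b u)).
  { apply (bounded_clamp (fun _ u _ => u)). lra. }
  assert (Lt : lipschitz_field (fun t u q => / Rmax w1 t)).
  { apply (lipschitz_inv (fun t _ _ => Rmax w1 t) w1); [easy | intros; apply Rmax_l|].
    apply (lipschitz_comp (Rmax w1)); [apply Rmax_lipschitz | apply lipschitz_t]. }
  assert (Bt : bounded_field (fun t u q => / Rmax w1 t)).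
  { apply (bounded_inv (fun t _ _ => Rmax w1 t) w1); [easy | intros; apply Rmax_l]. }
  assert (Lq : lipschitz_field (fun t u q => / Rmax q1 q)).
  { apply (lipschitz_inv (fun _ _ q => Rmax q1 q) q1); [easy | intros; apply Rmax_l|].
    apply (lipschitz_comp (Rmax q1)); [apply Rmax_lipschitz | apply lipschitz_q]. }
  assert (Bq : bounded_field (fun t u q => / Rmax q1 q)).
  { apply (bounded_inv (fun _ _ q => Rmax q1 q) q1); [easy | intros; apply Rmax_l]. }
  assert (LM : lipschitz_field (fun t u q => / (1 - clamp 0 (b - w1) (t - u)
    * clamp 0 (b - w1) (t - u) * / Rmax q1 q))).
  { apply (lipschitz_inv (fun t u q => 1 - clamp 0 (b - w1) (t - u)
      * clamp 0 (b - w1) (t - u) * / Rmax q1 q) _ hm mach_bound).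
    apply (lipschitz_comp (fun m => 1 - m)).
    - intros x y. replace (1 - x - (1 - y)) with (- (x - y)) by ring.
      rewrite Rabs_Ropp. lra.
    - apply (lipschitz_mult (fun t u q => clamp 0 (b - w1) (t - u)
        * clamp 0 (b - w1) (t - u))); auto using bounded_mult, lipschitz_mult. }
  assert (BM : bounded_field (fun t u q => / (1 - clamp 0 (b - w1) (t - u)
    * clamp 0 (b - w1) (t - u) * / Rmax q1 q))).
  { apply (bounded_inv (fun t u q => 1 - clamp 0 (b - w1) (t - u)
      * clamp 0 (b - w1) (t - u) * / Rmax q1 q) _ hm mach_bound). }
  split; unfold clamped_rate.
  - apply (lipschitz_mult (fun t u q => clamp w1 b u));
      auto using bounded_mult, lipschitz_mult.
  - apply (bounded_mult (fun t u q => clamp w1 b u)); auto using bounded_mult.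
Qed.

Lemma clamped_u_lipschitz : lipschitz_field clamped_u.
Proof.
  destruct clamped_rate_regular. unfold clamped_u.
  apply (lipschitz_mult (fun _ _ _ => -2)); auto using lipschitz_const, bounded_const.
Qed.

Lemma clamped_q_lipschitz : lipschitz_field clamped_q.
Proof.
  destruct clamped_rate_regular, clamped_v_regular. unfold clamped_q.
  apply (lipschitz_mult (fun _ _ _ => -2 * (g - 1)));
    auto using lipschitz_const, bounded_const.
  - apply (lipschitz_mult (fun t u q => clamp 0 (b - w1) (t - u))); auto.
  - apply (bounded_mult (fun t u q => clamp 0 (b - w1) (t - u))); auto.
Qed.

Lemma trapped_subsonic (t u q : R) : trapped t u q -> (u - t) ^ 2 < q.
Proof. intros [Ht Hu Hv Hq]. nra. Qed.

Lemma clamped_agrees (t u q : R) : trapped t u q ->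
  clamped_u t u q = euler_u t u q /\ clamped_q t u q = euler_q g t u q.
Proof.
  intros H. assert (Hs := trapped_subsonic t u q H).
  assert (hq := q1_pos). destruct H as [Ht Hu Hv Hq].
  unfold clamped_u, clamped_q, clamped_rate, euler_u, euler_q.
  rewrite !clamp_id, !Rmax_right by lra.
  split; field; repeat split; nra.
Qed.

Lemma clamped_u_neg (t u q : R) : clamped_u t u q < 0.
Proof. unfold clamped_u. assert (h := clamped_rate_pos t u q). lra. Qed.

Lemma clamped_q_nonpos (t u q : R) : clamped_q t u q <= 0.
Proof.
  unfold clamped_q. assert (h := clamped_rate_pos t u q).
  assert (hv := clamp_bounds 0 (b - w1) (t - u) ltac:(lra)).
  assert (0 <= (g - 1) * (clamp 0 (b - w1) (t - u) * clamped_rate t u q)).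
  { apply Rmult_le_pos; [lra|]. apply Rmult_le_pos; lra. }
  lra.
Qed.

(** A solution on [[a, b]] that ends in the state [(w1, q1)] and stays strictly
    subsonic, without any sign condition on the relative speed [t - u]. *)
Record subsonic_flow (a : R) (u q : R -> R) : Prop := {
  flow_dom : 0 < a <= b;
  flow_cont : forall t, a <= t <= b -> continuous u t /\ continuous q t;
  flow_pos : forall t, a <= t <= b -> 0 < u t /\ 0 < q t;
  flow_sub : forall t, a <= t <= b -> (u t - t) ^ 2 < q t;
  flow_ode : forall t, a < t < b ->
    is_derive u t (euler_u t (u t) (q t)) /\
    is_derive q t (euler_q g t (u t) (q t));
  flow_u1 : u b = w1;
  flow_q1 : q b = q1 }.

Lemma subsonic_flow_restrict (a a' : R) (u q : R -> R) :
  subsonic_flow a u q -> a <= a' <= b -> subsonic_flow a' u q.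
Proof.
  intros [h1 h2 h3 h4 h5 h6 h7] Ha.
  constructor; try easy; intros; try lra;
    [apply h2 | apply h3 | apply h4 | apply h5]; lra.
Qed.

Lemma subsonic_flow_decreasing (a : R) (u q : R -> R) (s t : R) :
  subsonic_flow a u q -> a <= s <= t -> t <= b -> u t <= u s.
Proof.
  intros H Hs Ht.
  apply (nonincreasing_from_derivative u (fun t => euler_u t (u t) (q t))); [lra | | |].
  - intros x Hx. apply (flow_cont _ _ _ H). lra.
  - intros x Hx. apply (flow_ode _ _ _ H). lra.
  - intros x Hx. unfold euler_u.
    assert (h0 := flow_dom _ _ _ H).
    destruct (flow_pos _ _ _ H x) as [h1 h2]; [lra|].
    assert (h3 := flow_sub _ _ _ H x ltac:(lra)).
    assert (h4 : / (x * ((u x - x) ^ 2 - q x)) < 0).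
    { apply Rinv_lt_0_compat. nra. }
    unfold Rdiv. assert (0 < 2 * q x * u x) by nra. nra.
Qed.

(** As [u] decreases, [t - u] increases, so [u a <= a] makes [t - u] nonnegative
    throughout and at most its final value; this in turn makes [q]
    nonincreasing. *)
Lemma subsonic_flow_trapped (a : R) (u q : R -> R) :
  subsonic_flow a u q -> u a <= a ->
  forall t, a <= t <= b -> trapped t (u t) (q t).
Proof.
  intros H Ha. assert (h0 := flow_dom _ _ _ H).
  assert (hb : u b = w1) by apply (flow_u1 _ _ _ H).
  assert (hv : forall t, a <= t <= b -> w1 <= u t /\ u t <= u a).
  { intros t Ht. rewrite <- hb. split; apply (subsonic_flow_decreasing a u q); easy || lra. }
  assert (Hmach : forall t, a <= t <= b -> 0 <= t - u t).
  { intros t Ht. specialize (hv t Ht). lra. }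
  intros t Ht. destruct (hv t Ht) as [h1 h2].
  constructor; [lra | lra | |].
  - split; [now apply Hmach|].
    assert (w1 <= u t) by easy. lra.
  - rewrite <- (flow_q1 _ _ _ H).
    apply (nonincreasing_from_derivative q (fun t => euler_q g t (u t) (q t))); [lra | | |].
    + intros x Hx. apply (flow_cont _ _ _ H). lra.
    + intros x Hx. apply (flow_ode _ _ _ H). lra.
    + intros x Hx. unfold euler_q.
      destruct (flow_pos _ _ _ H x) as [k1 k2]; [lra|].
      assert (k3 := flow_sub _ _ _ H x ltac:(lra)).
      assert (k4 : / (x * ((u x - x) ^ 2 - q x)) < 0).
      { apply Rinv_lt_0_compat. nra. }
      assert (k5 := Hmach x ltac:(lra)). unfold Rdiv.
      assert (k6 : 0 <= (g - 1) * u x * (x - u x) * q x).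
      { repeat apply Rmult_le_pos; lra. }
      nra.
Qed.

(** The clamped system is solved on [[w1, b]].  There [u >= w1], so [t - u] is
    nonpositive at [w1] and positive at [b], and vanishes at some [tau]; to the
    right of [tau] the state is trapped and clamping has no effect. *)
Lemma exists_maximal_flow : exists tau u q,
  0 < tau < b /\ u tau = tau /\ subsonic_flow tau u q /\
  forall t, tau <= t <= b -> is_derive u t (euler_u t (u t) (q t)) /\
    is_derive q t (euler_q g t (u t) (q t)).
Proof.
  destruct (planar_existence clamped_u clamped_q w1 b w1 q1)
    as [u [q [Hu [Hq Hd]]]];
    [lra | apply clamped_u_lipschitz | apply clamped_q_lipschitz |].
  assert (Hc : forall t, w1 <= t <= b -> continuous u t /\ continuous q t).
  { intros t Ht. destruct (Hd t Ht) as [h1 h2]. split.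
    - apply (ex_derive_continuous u). eexists; exact h1.
    - apply (ex_derive_continuous q). eexists; exact h2. }
  assert (Hmono : forall s t, w1 <= s <= t -> t <= b -> u t <= u s).
  { intros s t Hs Ht.
    apply (nonincreasing_from_derivative u (fun t => clamped_u t (u t) (q t))); [lra | | |].
    - intros; apply Hc; lra.
    - intros; apply Hd; lra.
    - intros; left; apply clamped_u_neg. }
  assert (Hqmono : forall t, w1 <= t <= b -> q1 <= q t).
  { intros t Ht. rewrite <- Hq.
    apply (nonincreasing_from_derivative q (fun t => clamped_q t (u t) (q t))); [lra | | |].
    - intros; apply Hc; lra.
    - intros; apply Hd; lra.
    - intros; apply clamped_q_nonpos. }
  destruct (ivt (fun t => t - u t) w1 b 0) as [tau [Htau Hz]]; [lra | | |].
  - intros t Ht. apply (continuous_minus (V:=R_NormedModule) (fun t => t));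
      [apply continuous_id | now apply Hc].
  - left. assert (h := Hmono w1 b ltac:(lra) ltac:(lra)). lra.
  - assert (tau <> b) by (intros ->; lra).
    assert (Htr : forall t, tau <= t <= b -> trapped t (u t) (q t)).
    { intros t Ht. assert (h1 := Hmono tau t ltac:(lra) ltac:(lra)).
      assert (h2 := Hmono t b ltac:(lra) ltac:(lra)).
      constructor; try lra. apply Hqmono; lra. }
    assert (Hode : forall t, tau <= t <= b ->
      is_derive u t (euler_u t (u t) (q t)) /\
      is_derive q t (euler_q g t (u t) (q t))).
    { intros t Ht. destruct (clamped_agrees _ _ _ (Htr t Ht)) as [<- <-].
      apply Hd. lra. }
    exists tau, u, q. split; [lra|]. split; [lra|]. split; [|exact Hode].
    constructor; try easy.
    + lra.
    + intros t Ht. apply Hc. lra.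
    + intros t Ht. assert (h := q1_pos). destruct (Htr t Ht). lra.
    + intros t Ht. now apply trapped_subsonic, Htr.
    + intros t Ht. apply Hode. lra.
Qed.

(** Both flows solve the clamped system, whose solutions are unique. *)
Lemma trapped_flows_agree (a : R) (u q u' q' : R -> R) :
  subsonic_flow a u q -> subsonic_flow a u' q' -> u a <= a -> u' a <= a ->
  u a = u' a /\ q a = q' a.
Proof.
  intros H H' Ha Ha'.
  assert (T := subsonic_flow_trapped a u q H Ha).
  assert (T' := subsonic_flow_trapped a u' q' H' Ha').
  apply (planar_uniqueness clamped_u clamped_q a b).
  - apply (flow_dom _ _ _ H).
  - apply clamped_u_lipschitz.
  - apply clamped_q_lipschitz.
  - apply (flow_cont _ _ _ H).
  - apply (flow_cont _ _ _ H').
  - intros t Ht. destruct (clamped_agrees _ _ _ (T t ltac:(lra))) as [-> ->].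
    now apply (flow_ode _ _ _ H).
  - intros t Ht. destruct (clamped_agrees _ _ _ (T' t ltac:(lra))) as [-> ->].
    now apply (flow_ode _ _ _ H').
  - now rewrite (flow_u1 _ _ _ H), (flow_u1 _ _ _ H').
  - now rewrite (flow_q1 _ _ _ H), (flow_q1 _ _ _ H').
Qed.

Section Maximal.
Context (tau : R) (U Q : R -> R) (Htau : U tau = tau)
  (HU : subsonic_flow tau U Q).

Lemma flow_below_diagonal (a t : R) (u q : R -> R) :
  subsonic_flow a u q -> u a <= a -> a <= t <= b -> u t <= t.
Proof.
  intros H Ha Ht. destruct (subsonic_flow_trapped a u q H Ha t Ht). lra.
Qed.

Lemma flow_agrees_with_maximal (a t : R) (u q : R -> R) :
  subsonic_flow a u q -> u a <= a -> a <= t <= b -> tau <= t ->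
  u t = U t /\ q t = Q t.
Proof.
  intros H Ha Ht Ht'. apply (trapped_flows_agree t).
  - now apply (subsonic_flow_restrict a).
  - apply (subsonic_flow_restrict tau); [easy | lra].
  - now apply (flow_below_diagonal a t u q).
  - apply (flow_below_diagonal tau t U Q); try easy; lra.
Qed.

(** A flow reaching further left than [tau] would take the value [tau] at
    [tau], and a value at least [tau] at [a < tau], which is above the
    diagonal. *)
Lemma trapped_flow_starts_after_maximal (a : R) (u q : R -> R) :
  subsonic_flow a u q -> u a <= a -> tau <= a.
Proof.
  intros H Ha. apply Rnot_lt_le. intros Hlt.
  assert (h0 := flow_dom _ _ _ HU).
  destruct (flow_agrees_with_maximal a tau u q H Ha) as [h _]; [lra | lra |].
  assert (h2 := subsonic_flow_decreasing a u q a tau H ltac:(lra) ltac:(lra)). lra.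
Qed.

(** Otherwise the flow would meet the diagonal at some [s > a >= tau].  From
    [s] on it is trapped and so equals [U]; but [U s <= U tau = tau < s]. *)
Lemma flow_on_maximal_interval_trapped (a : R) (u q : R -> R) :
  subsonic_flow a u q -> tau <= a -> u a <= a.
Proof.
  intros H Ha. apply Rnot_lt_le. intros Hlt.
  assert (h0 := flow_dom _ _ _ H).
  destruct (ivt (fun t => t - u t) a b 0) as [s [Hs Hz]]; [lra | | |].
  - intros t Ht. apply (continuous_minus (V:=R_NormedModule) (fun t => t));
      [apply continuous_id | now apply (flow_cont _ _ _ H)].
  - left. rewrite (flow_u1 _ _ _ H). lra.
  - assert (a <> s) by (intros ->; lra).
    assert (H' := subsonic_flow_restrict a s u q H ltac:(lra)).
    destruct (flow_agrees_with_maximal s s u q H') as [h _]; [lra.. |].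
    assert (h2 := subsonic_flow_decreasing tau U Q tau s HU ltac:(lra) ltac:(lra)).
    lra.
Qed.
End Maximal.
End Subsonic.


(** * Real powers and one-sided derivatives *)

Lemma rpow_pos (x a : R) : 0 < x -> rpow x a = Rpower x a.
Proof. intros Hx. unfold rpow. destruct Req_EM_T; [lra | easy]. Qed.

Lemma rpow_nonneg (x a : R) : 0 <= rpow x a.
Proof.
  unfold rpow. destruct Req_EM_T; [lra|]. left. apply exp_pos.
Qed.

Lemma Rpower_is_derive (x a : R) : 0 < x ->
  is_derive (fun x => Rpower x a) x (a * (Rpower x a / x)).
Proof.
  intros Hx. unfold Rpower. auto_derive; [easy|]. field. lra.
Qed.

(** The absolute value matters: [Rpower] is [1] at negative bases, so [rpow] is
    discontinuous at [0] from the left. *)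
Lemma rpow_abs_continuous (a x : R) : 0 < a ->
  continuous (fun x => rpow (Rabs x) a) x.
Proof.
  intros Ha. destruct (Req_dec x 0) as [->|Hx].
  - apply filterlim_locally. intros [eps He].
    exists (mkposreal (Rpower eps (/ a)) (exp_pos _)). intros y Hy.
    change (Rabs (y - 0) < Rpower eps (/ a)) in Hy. rewrite Rminus_0_r in Hy.
    change (Rabs (rpow (Rabs y) a - rpow (Rabs 0) a) < eps).
    rewrite Rabs_R0. unfold rpow at 2. destruct (Req_EM_T 0 0); [|lra].
    rewrite Rminus_0_r, Rabs_pos_eq by apply rpow_nonneg.
    unfold rpow. destruct Req_EM_T as [_|Hy0]; [easy|].
    assert (0 < Rabs y) by (assert (h := Rabs_pos y); lra).
    replace eps with (Rpower (Rpower eps (/ a)) a).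
    + apply Rlt_Rpower_l; [easy | now split].
    + rewrite Rpower_mult, Rinv_l, Rpower_1; lra.
  - apply (continuous_comp Rabs (fun y => rpow y a)); [apply continuous_Rabs|].
    assert (Hp := Rabs_pos_lt x Hx).
    apply (continuous_ext_loc _ (fun y => Rpower y a)).
    + apply (locally_open (fun y => 0 < y)); [apply open_gt | | easy].
      intros y Hy. symmetry. now apply rpow_pos.
    + apply (ex_derive_continuous (V:=R_NormedModule)).
      eexists. now apply Rpower_is_derive.
Qed.

(** Composition with [clamp] turns relative continuity on an interval into
    continuity on the line, so that the lemmas about functions on the line apply
    to solutions. *)
Lemma continuous_clamped (f : R -> R) (s a b : R) :
  s <= a -> a <= b -> continuous_on (Icc s b) f ->
  forall t, continuous (fun t => f (clamp a b t)) t.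
Proof.
  intros Hs Hab Hf t. assert (hc := clamp_bounds a b t Hab).
  apply (filterlim_comp _ _ _ (clamp a b) f _ (within (Icc s b) (locally (clamp a b t)))).
  - intros P HP.
    assert (H := clamp_continuous a b t _ HP). unfold filtermap in H |- *.
    revert H. apply filter_imp.
    intros y Hy. apply Hy. assert (h := clamp_bounds a b y Hab). split; lra.
  - apply Hf. split; lra.
Qed.

Lemma D_in_is_derive (f d : R -> R) (s b t : R) :
  s < t < b -> D_in f d (Icc s b) t -> is_derive f t (d t).
Proof.
  intros Ht H. apply is_derive_Reals. intros eps He.
  destruct (H eps He) as [del [Hdel Hd]].
  assert (Hm : 0 < Rmin del (Rmin (t - s) (b - t))).
  { repeat apply Rmin_glb_lt; lra. }
  exists (mkposreal _ Hm). simpl. intros h Hh0 Hh.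
  assert (h1 := Rmin_l del (Rmin (t - s) (b - t))).
  assert (h2 := Rmin_r del (Rmin (t - s) (b - t))).
  assert (h3 := Rmin_l (t - s) (b - t)). assert (h4 := Rmin_r (t - s) (b - t)).
  assert (h5 := Rle_abs h). assert (h6 := Rle_abs (- h)). rewrite Rabs_Ropp in h6.
  specialize (Hd (t + h)). simpl in Hd. unfold Rdist in Hd.
  replace (t + h - t) with h in Hd by ring. apply Hd.
  unfold D_x, Icc. repeat split; lra.
Qed.

Lemma is_derive_clamped (f : R -> R) (a b t l : R) : a < t < b ->
  is_derive f t l -> is_derive (fun t => f (clamp a b t)) t l.
Proof.
  intros Ht H. apply (is_derive_ext_loc f); [|easy].
  apply (locally_interval _ t a b); simpl; try lra.
  intros y h1 h2. simpl in *. rewrite clamp_id; [easy | lra].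
Qed.

Lemma is_derive_D_in (f d : R -> R) (D : R -> Prop) (t : R) :
  is_derive f t (d t) -> D_in f d D t.
Proof.
  intros H eps He. apply is_derive_Reals in H.
  destruct (H eps He) as [[del Hdel] Hd]. exists del. split; [easy|].
  intros y [[_ Hy] Hyt]. simpl in *. unfold Rdist in *.
  replace y with (t + (y - t)) at 1 by ring.
  apply Hd; [lra | easy].
Qed.

(** * The state behind the shock, and passage between the two systems *)

Definition sound_sq (gamma_u rho0 p0 sigma_p r : R) : R :=
  sound gamma_u rho0 p0 sigma_p r ^ 2.

(** The density of squared sound speed [q], obtained by inverting the relation
    between [q] and [rho] normalised at the shock. *)
Definition flow_density (gamma_u rho0 p0 sigma_p : R) (q : R -> R) (t : R) : R :=
  let r := rho1 gamma_u rho0 p0 sigma_p in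
  r * Rpower (q t / sound_sq gamma_u rho0 p0 sigma_p r) (/ (gamma_u - 1)).

Section Shock.
Context (g rho0 p0 sp : R) (hg : 1 < g) (hr : 0 < rho0) (hp : 0 < p0)
  (hs : c0 g rho0 p0 < sp).
Local Notation r1 := (rho1 g rho0 p0 sp).
Local Notation w1 := (u1 g rho0 p0 sp).
Local Notation kappa := (s1 g rho0 p0 sp).
Local Notation c2 := (sound_sq g rho0 p0 sp).
Local Notation density := (flow_density g rho0 p0 sp).

Lemma c0_pos : 0 < c0 g rho0 p0.
Proof.
  unfold c0. apply sqrt_lt_R0. apply Rdiv_lt_0_compat; [nra | easy].
Qed.

(** Put [m = 1 / M_p ^ 2] and [th = rho_0 / rho_1].  Then the relative speed
    behind the shock is [th * sp] and its squared sound speed is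
    [th * sp ^ 2 * (m + g * (1 - th))].  As [th * (g + 1) = g - 1 + 2 * m], the
    state is subsonic exactly when [m < 1], that is when the shock is
    supersonic with respect to the gas ahead of it. *)
Lemma shock_facts : 0 < r1 /\ 0 < kappa /\ 0 < w1 < sp /\ (sp - w1) ^ 2 < c2 r1.
Proof.
  assert (hc := c0_pos).
  set (m := / Mp g rho0 p0 sp ^ 2).
  assert (hM : 1 < Mp g rho0 p0 sp).
  { unfold Mp. apply (Rmult_lt_reg_r (c0 g rho0 p0)); [easy|].
    unfold Rdiv. rewrite Rmult_assoc, Rinv_l; lra. }
  assert (hm : 0 < m < 1).
  { unfold m. split; [apply Rinv_0_lt_compat; nra|].
    rewrite <- Rinv_1. apply Rinv_lt_contravar; nra. }
  set (th := (g - 1 + 2 * m) / (g + 1)).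
  assert (hth : 0 < th < 1).
  { unfold th. split; [apply Rdiv_lt_0_compat; lra|].
    apply (Rmult_lt_reg_r (g + 1)); [lra|].
    unfold Rdiv. rewrite Rmult_assoc, Rinv_l; lra. }
  assert (hr1 : r1 = rho0 / th).
  { unfold rho1, th, m. field. repeat split; nra. }
  assert (hratio : rho0 / r1 = th) by (rewrite hr1; field; lra).
  assert (hp0 : g * p0 = rho0 * (sp ^ 2 * m)).
  { assert (hc2 : c0 g rho0 p0 ^ 2 = g * p0 / rho0).
    { apply pow2_sqrt. left. apply Rdiv_lt_0_compat; [nra | easy]. }
    unfold m, Mp.
    replace (rho0 * (sp ^ 2 * / (sp / c0 g rho0 p0) ^ 2)) with
      (rho0 * c0 g rho0 p0 ^ 2) by (field; lra).
    rewrite hc2. field. lra. }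
  assert (hr1p : 0 < r1) by (rewrite hr1; now apply Rdiv_lt_0_compat).
  assert (hw1 : w1 = (1 - th) * sp) by (unfold u1; fold r1; now rewrite hratio).
  assert (hp1 : p1 g rho0 p0 sp = p0 + (1 - th) * rho0 * sp ^ 2)
    by (unfold p1; fold r1; now rewrite hratio).
  assert (hp1p : 0 < p1 g rho0 p0 sp).
  { rewrite hp1. assert (0 <= (1 - th) * rho0 * sp ^ 2); [|lra].
    apply Rmult_le_pos; [nra | apply pow2_ge_0]. }
  assert (hsp : 0 < kappa).
  { unfold s1. fold r1. rewrite rpow_pos by easy.
    apply Rdiv_lt_0_compat; [easy | apply exp_pos]. }
  assert (hc1 : c2 r1 = g * p1 g rho0 p0 sp / r1).
  { unfold sound_sq, sound.
    rewrite pow2_sqrt by (apply Rmult_le_pos; [nra | apply rpow_nonneg]).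
    unfold s1. fold r1. rewrite !rpow_pos by easy.
    unfold Rminus. rewrite Rpower_plus, Rpower_Ropp, Rpower_1 by easy.
    field. split; [lra | apply Rgt_not_eq, exp_pos]. }
  split; [easy|]. split; [easy|]. split; [rewrite hw1; nra|].
  rewrite hc1, hw1, hp1, hr1.
  replace (g * (p0 + (1 - th) * rho0 * sp ^ 2) / (rho0 / th)) with
    (th * (sp ^ 2 * m + g * (1 - th) * sp ^ 2)).
  2:{ replace (g * (p0 + (1 - th) * rho0 * sp ^ 2)) with
        (rho0 * (sp ^ 2 * m) + g * (1 - th) * rho0 * sp ^ 2) by (rewrite <- hp0; ring).
      field. lra. }
  assert (hsp2 : 0 < sp ^ 2) by nra.
  replace ((sp - (1 - th) * sp) ^ 2) with (th * sp ^ 2 * th) by ring.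
  replace (th * (sp ^ 2 * m + g * (1 - th) * sp ^ 2)) with
    (th * sp ^ 2 * (m + g * (1 - th))) by ring.
  apply Rmult_lt_compat_l; [nra|].
  assert (hthe : th * (g + 1) = g - 1 + 2 * m) by (unfold th; field; lra). lra.
Qed.

Lemma c2_rpow (r : R) : c2 r = g * kappa * rpow r (g - 1).
Proof.
  destruct shock_facts as (_ & h & _). unfold sound_sq, sound.
  apply pow2_sqrt. apply Rmult_le_pos; [nra | apply rpow_nonneg].
Qed.

Lemma c2_pos (r : R) : 0 < r -> 0 < c2 r.
Proof.
  intros Hr. destruct shock_facts as (_ & h & _).
  rewrite c2_rpow, rpow_pos by easy. apply Rmult_lt_0_compat; [nra | apply exp_pos].
Qed.

Lemma c2_injective (r r' : R) : 0 < r -> 0 < r' -> c2 r = c2 r' -> r = r'.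
Proof.
  intros Hr Hr'. destruct shock_facts as (_ & h & _).
  rewrite !c2_rpow, !rpow_pos by easy. intros H.
  apply Rmult_eq_reg_l in H; [|nra].
  unfold Rpower in H. apply exp_inv, Rmult_eq_reg_l in H; [|lra].
  now apply ln_inv.
Qed.

Lemma c2_abs_continuous (x : R) : continuous (fun x => c2 (Rabs x)) x.
Proof.
  apply (continuous_ext (fun x => g * kappa * rpow (Rabs x) (g - 1))).
  - intros y. now rewrite c2_rpow.
  - apply (continuous_mult (fun _ => g * kappa)); [apply continuous_const|].
    apply rpow_abs_continuous. lra.
Qed.

Lemma c2_is_derive (r : R) : 0 < r -> is_derive c2 r ((g - 1) * (c2 r / r)).
Proof.
  intros Hr. apply (is_derive_ext_loc (fun x => g * kappa * Rpower x (g - 1))).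
  - apply (locally_open (fun y => 0 < y)); [apply open_gt | | easy].
    intros y Hy. now rewrite c2_rpow, rpow_pos.
  - rewrite c2_rpow, rpow_pos by easy.
    replace ((g - 1) * (g * kappa * Rpower r (g - 1) / r)) with
      (g * kappa * ((g - 1) * (Rpower r (g - 1) / r))) by (field; lra).
    apply (is_derive_scal (fun x => Rpower x (g - 1))). now apply Rpower_is_derive.
Qed.

(** The interval may be shortened to [[a, sp]], with [a > 0], because the
    system is singular at [x = 0].  [D] does not vanish and is negative at
    [sp], so it is negative by the intermediate value theorem; positivity of
    [rho] and [u] follows since each solves a homogeneous linear equation with
    continuous coefficient. *)
Lemma solution_gives_flow (sigma a : R) (rho u : R -> R) :
  solution g rho0 p0 sp sigma rho u -> sigma <= a < sp -> 0 < a ->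
  subsonic_flow g sp w1 (c2 r1) a (fun t => u (clamp a sp t))
    (fun t => c2 (rho (clamp a sp t))) /\
  forall t, a <= t <= sp -> 0 < rho t.
Proof.
  intros (Hsig & Crho & Cu & _ & _ & Hrho & Hode & Hr1 & Hu1) Ha Ha0.
  destruct shock_facts as (hr1 & hsp & hw1 & hsub).
  set (R_ t := rho (clamp a sp t)). set (U t := u (clamp a sp t)).
  assert (CR : forall t, continuous R_ t)
    by (apply (continuous_clamped rho sigma); easy || lra).
  assert (CU : forall t, continuous U t)
    by (apply (continuous_clamped u sigma); easy || lra).
  assert (HR0 : forall t, 0 <= R_ t).
  { intros t. assert (h := clamp_bounds a sp t ltac:(lra)). apply Hrho. split; lra. }
  set (Q t := c2 (R_ t)).
  assert (CQ : forall t, continuous Q t).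
  { intros t. apply (continuous_ext (fun t => c2 (Rabs (R_ t)))).
    - intros x. unfold Q. now rewrite Rabs_pos_eq.
    - apply (continuous_comp R_ (fun x => c2 (Rabs x)));
        [apply CR | apply c2_abs_continuous]. }
  set (D t := (U t - t) ^ 2 - Q t).
  assert (CD : forall t, continuous D t).
  { intros t. apply (continuous_minus (V:=R_NormedModule)); [|apply CQ].
    apply (continuous_sqr (fun t => U t - t)).
    apply (continuous_minus (V:=R_NormedModule) U); [apply CU | apply continuous_id]. }
  assert (HRb : R_ sp = r1) by (unfold R_; now rewrite clamp_id by lra).
  assert (HUb : U sp = w1) by (unfold U; now rewrite clamp_id by lra).
  assert (HD0 : forall t, a <= t <= sp -> D t <> 0).
  { intros t Ht. unfold D, U, Q, R_. rewrite clamp_id by easy.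
    apply Hode. repeat split; lra. }
  assert (HDb : D sp < 0).
  { unfold D, Q. rewrite HRb, HUb.
    replace ((w1 - sp) ^ 2) with ((sp - w1) ^ 2) by ring. lra. }
  assert (HD : forall t, a <= t <= sp -> D t < 0).
  { intros t Ht. apply Rnot_le_lt. intros Hpos.
    destruct (ivt D t sp 0) as [z [Hz Hz0]]; [lra | auto | lra|].
    apply (HD0 z); [lra | easy]. }
  assert (HdR : forall t, a < t < sp ->
    is_derive R_ t (- (2 * U t * (U t - t)) / (t * D t) * R_ t)).
  { intros t Ht. unfold D, Q, U, R_ at 2 3. rewrite clamp_id by lra.
    apply is_derive_clamped; [easy|].
    refine (D_in_is_derive rho (fun y => - (2 * u y * (u y - y)) /
      (y * ((u y - y) ^ 2 - sound g rho0 p0 sp (rho y) ^ 2)) * rho y) sigma sp t _ _);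
      [lra|]. apply Hode. repeat split; lra. }
  assert (HdU : forall t, a < t < sp ->
    is_derive U t (2 * Q t / (t * D t) * U t)).
  { intros t Ht. unfold D, Q, U at 2 3, R_. rewrite clamp_id by lra.
    apply is_derive_clamped; [easy|].
    refine (D_in_is_derive u (fun y => 2 * sound g rho0 p0 sp (rho y) ^ 2 /
      (y * ((u y - y) ^ 2 - sound g rho0 p0 sp (rho y) ^ 2)) * u y) sigma sp t _ _);
      [lra|]. apply Hode. repeat split; lra. }
  assert (CtD : forall n : R -> R, (forall t, continuous n t) ->
    forall t, continuous (fun t => n (clamp a sp t) / (clamp a sp t * D (clamp a sp t))) t).
  { intros n Cn t.
    apply (continuous_comp (clamp a sp) (fun t => n t / (t * D t))); [apply clamp_continuous|].
    assert (h := clamp_bounds a sp t ltac:(lra)).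
    apply (continuous_mult n); [apply Cn|].
    apply (continuous_comp (fun t => t * D t) Rinv).
    - apply (continuous_mult (U:=R_UniformSpace) (K:=R_AbsRing) (fun t => t));
        [apply continuous_id | apply CD].
    - assert (h' := HD0 _ h).
      apply (ex_derive_continuous (V:=R_NormedModule)). auto_derive.
      apply Rmult_integral_contrapositive. split; lra. }
  assert (HR : forall t, a <= t <= sp -> 0 < R_ t).
  { apply (linear_ode_positive R_ (fun t => - (2 * U (clamp a sp t)
      * (U (clamp a sp t) - clamp a sp t)) / (clamp a sp t * D (clamp a sp t)))).
    - apply (CtD (fun t => - (2 * U t * (U t - t)))). intros t.
      apply (continuous_opp (V:=R_NormedModule)).
      apply (continuous_mult (fun t => 2 * U t)).
      + apply (continuous_mult (fun _ => 2)); [apply continuous_const | apply CU].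
      + apply (continuous_minus (V:=R_NormedModule) U); [apply CU | apply continuous_id].
    - intros; apply CR.
    - intros t Ht. rewrite clamp_id by lra. now apply HdR.
    - now rewrite HRb. }
  assert (HU : forall t, a <= t <= sp -> 0 < U t).
  { apply (linear_ode_positive U (fun t => 2 * Q (clamp a sp t)
      / (clamp a sp t * D (clamp a sp t)))).
    - apply (CtD (fun t => 2 * Q t)). intros t.
      apply (continuous_mult (fun _ => 2)); [apply continuous_const | apply CQ].
    - intros; apply CU.
    - intros t Ht. rewrite clamp_id by lra. now apply HdU.
    - rewrite HUb. lra. }
  split.
  2:{ intros t Ht. specialize (HR t Ht). unfold R_ in HR. now rewrite clamp_id in HR. }
  constructor.
  - lra.
  - intros t Ht. split; [apply CU | apply CQ].
  - intros t Ht. split; [now apply HU|]. now apply c2_pos, HR.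
  - intros t Ht. assert (h := HD t Ht). unfold D in h. fold (U t) (R_ t) (Q t). lra.
  - intros t Ht. split; [now apply HdU|].
    assert (h1 := HdR t Ht). assert (h2 : 0 < R_ t) by (apply HR; lra).
    assert (h3 := is_derive_comp c2 R_ t _ _ (c2_is_derive (R_ t) h2) h1).
    unfold euler_q. fold (U t) (R_ t) (Q t) (D t).
    fold (Q t) in h3.
    apply (is_derive_eq _ _ _ _ h3).
    unfold scal; simpl; unfold mult; simpl.
    assert (h4 := HD0 t ltac:(lra)). field. repeat split; lra.
  - easy.
  - fold (R_ sp). now rewrite HRb.
Qed.

Lemma sound_sq_flow_density (Q : R -> R) (t : R) :
  0 < Q t -> c2 (density Q t) = Q t.
Proof.
  intros HQ. destruct shock_facts as (hr1 & hsp & _).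
  assert (h1 := c2_pos r1 hr1). assert (h2 := c2_rpow r1).
  assert (h3 : 0 < Q t / c2 r1) by now apply Rdiv_lt_0_compat.
  assert (h4 : 0 < density Q t) by (apply Rmult_lt_0_compat; [easy | apply exp_pos]).
  rewrite c2_rpow, rpow_pos by easy. rewrite rpow_pos in h2 by easy.
  unfold flow_density. rewrite <- Rpower_mult_distr by (easy || apply exp_pos).
  rewrite Rpower_mult, Rinv_l, Rpower_1 by lra.
  rewrite <- Rmult_assoc, <- h2. field. lra.
Qed.

(** The equations are assumed at the endpoints as well, since a solution
    satisfies them there in the one-sided sense. *)
Lemma flow_gives_solution (tau : R) (U Q : R -> R) :
  0 < tau < sp -> subsonic_flow g sp w1 (c2 r1) tau U Q ->
  (forall t, tau <= t <= sp -> is_derive U t (euler_u t (U t) (Q t)) /\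
    is_derive Q t (euler_q g t (U t) (Q t))) ->
  solution g rho0 p0 sp tau (density Q) U.
Proof.
  intros Htau H Hode. destruct shock_facts as (hr1 & hsp & hw1 & hsub).
  assert (hQ : forall t, tau <= t <= sp -> 0 < Q t)
    by (intros; now apply (flow_pos _ _ _ _ _ _ _ H)).
  assert (hD : forall t, tau <= t <= sp -> (U t - t) ^ 2 - Q t < 0).
  { intros t Ht. assert (h := flow_sub _ _ _ _ _ _ _ H t Ht). lra. }
  assert (hc : forall t, tau <= t <= sp -> sound g rho0 p0 sp (density Q t) ^ 2 = Q t).
  { intros t Ht. apply (sound_sq_flow_density Q t). now apply hQ. }
  set (du := fun y => 2 * sound g rho0 p0 sp (density Q y) ^ 2 /
      (y * ((U y - y) ^ 2 - sound g rho0 p0 sp (density Q y) ^ 2)) * U y).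
  set (dr := fun y => - (2 * U y * (U y - y)) /
      (y * ((U y - y) ^ 2 - sound g rho0 p0 sp (density Q y) ^ 2)) * density Q y).
  assert (hdu : forall t, tau <= t <= sp -> is_derive U t (du t)).
  { intros t Ht. unfold du. rewrite hc by easy. now apply Hode. }
  assert (hdr : forall t, tau <= t <= sp -> is_derive (density Q) t (dr t)).
  { intros t Ht. unfold dr. rewrite hc by easy.
    destruct (Hode t Ht) as [_ h]. specialize (hQ t Ht). specialize (hD t Ht).
    assert (h1 := c2_pos r1 hr1).
    assert (h3 : 0 < Q t / c2 r1) by now apply Rdiv_lt_0_compat.
    assert (k : is_derive (fun x => r1 * Rpower (x / c2 r1) (/ (g - 1))) (Q t)
      (r1 * (/ (g - 1) * (Rpower (Q t / c2 r1) (/ (g - 1)) / (Q t / c2 r1)) / c2 r1))).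
    { apply (is_derive_scal (fun x => Rpower (x / c2 r1) (/ (g - 1)))).
      assert (k0 : is_derive (fun x => x / c2 r1) (Q t) (/ c2 r1)).
      { auto_derive; [easy|]. ring. }
      assert (k2 := is_derive_comp (fun x => Rpower x (/ (g - 1)))
        (fun x => x / c2 r1) (Q t) _ _ (Rpower_is_derive _ (/ (g - 1)) h3) k0).
      apply (is_derive_eq _ _ _ _ k2).
      unfold scal; simpl; unfold mult; simpl. field. repeat split; lra. }
    assert (k2 := is_derive_comp _ Q t _ _ k h).
    apply (is_derive_eq _ _ _ _ k2).
    unfold scal; simpl; unfold mult; simpl. unfold euler_q, flow_density.
    field. repeat split; lra. }
  assert (cU : forall t, tau <= t <= sp -> continuous U t)
    by (intros; now apply (flow_cont _ _ _ _ _ _ _ H)).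
  assert (cQ : forall t, tau <= t <= sp -> continuous Q t)
    by (intros; now apply (flow_cont _ _ _ _ _ _ _ H)).
  assert (cR : forall t, tau <= t <= sp -> continuous (density Q) t).
  { intros t Ht. apply (ex_derive_continuous (density Q)). eexists. now apply hdr. }
  assert (cV : forall t, tau <= t <= sp -> continuous (fun t => U t - t) t).
  { intros t Ht. apply (continuous_minus (V:=R_NormedModule) U);
      [now apply cU | apply continuous_id]. }
  assert (cD : forall t, tau <= t <= sp ->
    continuous (fun t => / (t * ((U t - t) ^ 2 - Q t))) t).
  { intros t Ht. apply (continuous_comp (fun t => t * ((U t - t) ^ 2 - Q t)) Rinv).
    - apply (continuous_mult (U:=R_UniformSpace) (K:=R_AbsRing) (fun t => t));
        [apply continuous_id|].
      apply (continuous_minus (V:=R_NormedModule)); [|now apply cQ].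
      now apply (continuous_sqr (fun t => U t - t)), cV.
    - specialize (hD t Ht). apply (ex_derive_continuous (V:=R_NormedModule)). auto_derive.
      apply Rmult_integral_contrapositive. split; lra. }
  assert (hC1u : C1_pos U tau sp).
  { exists du. split.
    - intros t [Ht _]. apply is_derive_D_in. now apply hdu.
    - apply (continuous_on_ext _ (fun t => 2 * Q t * / (t * ((U t - t) ^ 2 - Q t)) * U t)).
      + intros t [Ht _]. unfold du. now rewrite hc.
      + apply continuous_on_forall. intros t [Ht _].
        apply (continuous_mult (fun t => 2 * Q t * / (t * ((U t - t) ^ 2 - Q t))));
          [|now apply cU].
        apply (continuous_mult (fun t => 2 * Q t)); [|now apply cD].
        apply (continuous_mult (fun _ => 2)); [apply continuous_const | now apply cQ]. }
  assert (hC1r : C1_pos (density Q) tau sp).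
  { exists dr. split.
    - intros t [Ht _]. apply is_derive_D_in. now apply hdr.
    - apply (continuous_on_ext _ (fun t => - (2 * U t * (U t - t))
        * / (t * ((U t - t) ^ 2 - Q t)) * density Q t)).
      + intros t [Ht _]. unfold dr. now rewrite hc.
      + apply continuous_on_forall. intros t [Ht _].
        apply (continuous_mult (fun t => - (2 * U t * (U t - t)) *
          / (t * ((U t - t) ^ 2 - Q t)))); [|now apply cR].
        apply (continuous_mult (fun t => - (2 * U t * (U t - t)))); [|now apply cD].
        apply (continuous_opp (V:=R_NormedModule)).
        apply (continuous_mult (fun t => 2 * U t)); [|now apply cV].
        apply (continuous_mult (fun _ => 2)); [apply continuous_const | now apply cU]. }
  unfold solution. cbv zeta. split; [lra|].
  split; [apply continuous_on_forall; exact cR|].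
  split; [apply continuous_on_forall; exact cU|].
  split; [easy|]. split; [easy|].
  split; [|split; [|split]].
  - intros t Ht. apply Rmult_le_pos; [lra | left; apply exp_pos].
  - intros t [Ht _]. split; [|split].
    + rewrite hc by easy. specialize (hD t Ht). lra.
    + apply (is_derive_D_in (density Q) dr). now apply hdr.
    + apply (is_derive_D_in U du). now apply hdu.
  - unfold flow_density. rewrite (flow_q1 _ _ _ _ _ _ _ H). fold r1.
    assert (h1 := c2_pos r1 hr1).
    unfold Rdiv. rewrite Rinv_r by lra. unfold Rpower.
    rewrite ln_1, Rmult_0_r, exp_0. ring.
  - apply (flow_u1 _ _ _ _ _ _ _ H).
Qed.
End Shock.

(** * Identification of the left endpoint *)

Theorem lemma2p3 (gamma_u rho0 p0 sigma_p : R)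
  (hgamma : 1 < gamma_u) (hrho0 : 0 < rho0) (hp0 : 0 < p0)
  (hsigma : c0 gamma_u rho0 p0 < sigma_p) :
  exists rho u : R -> R,
    solution gamma_u rho0 p0 sigma_p (sigma_l gamma_u rho0 p0 sigma_p) rho u /\
    forall rho' u' : R -> R,
      solution gamma_u rho0 p0 sigma_p (sigma_l gamma_u rho0 p0 sigma_p)
        rho' u' ->
      forall x, sigma_l gamma_u rho0 p0 sigma_p <= x <= sigma_p ->
        rho' x = rho x /\ u' x = u x.
Proof.
  destruct (shock_facts _ _ _ _ hgamma hrho0 hp0 hsigma) as (hr1 & hs & hw1 & hsub).
  set (w1 := u1 gamma_u rho0 p0 sigma_p) in *.
  set (q1 := sound_sq gamma_u rho0 p0 sigma_p (rho1 gamma_u rho0 p0 sigma_p)) in *.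
  destruct (exists_maximal_flow gamma_u sigma_p w1 q1)
    as (tau & U & Q & Htau & HU & HF & Hode);
    try easy.
  assert (Hsol := flow_gives_solution _ _ _ _ hgamma hrho0 hp0 hsigma tau U Q Htau HF Hode).
  set (rho := flow_density gamma_u rho0 p0 sigma_p Q) in *.
  assert (Hbelow : forall t, tau <= t <= sigma_p -> U t <= t).
  { intros t Ht. apply (flow_below_diagonal gamma_u sigma_p w1 q1)
      with (a := tau) (q := Q); try easy; lra. }
  assert (Hl : sigma_l gamma_u rho0 p0 sigma_p = tau).
  { unfold sigma_l. rewrite (is_glb_Rbar_unique _ (Finite tau)); [easy|]. split.
    - intros sigma [Hs (rho' & u' & H' & Hb)]. simpl. apply Rnot_lt_le. intros Hlt.
      (* [sigma] may be [0]; the midpoint is positive and still left of [tau]. *)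
      set (a := (sigma + tau) / 2).
      assert (Ha : sigma < a < tau) by (unfold a; lra).
      destruct (solution_gives_flow _ _ _ _ hgamma hrho0 hp0 hsigma sigma a rho' u' H')
        as [F _]; [lra | lra |].
      assert (tau <= a); [|lra].
      apply (trapped_flow_starts_after_maximal gamma_u sigma_p w1 q1 hgamma (proj1 hw1)
        (proj2 hw1) hsub tau U Q HU HF a _ _ F).
      rewrite clamp_id by lra. apply Hb. split; lra.
    - intros l Hl. apply Hl. split; [lra|]. exists rho, U. split; [easy|].
      intros t Ht. split; [split|].
      + left. now apply (flow_pos _ _ _ _ _ _ _ HF).
      + now apply Hbelow.
      + now apply Hsol. }
  rewrite Hl. exists rho, U. split; [easy|].
  intros rho' u' H' x Hx.
  destruct (solution_gives_flow _ _ _ _ hgamma hrho0 hp0 hsigma tau tau rho' u' H')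
    as [F Hpos]; [lra | lra |].
  destruct (solution_gives_flow _ _ _ _ hgamma hrho0 hp0 hsigma tau tau rho U Hsol)
    as [_ Hpos0]; [lra | lra |].
  assert (Hd : u' (clamp tau sigma_p tau) <= tau).
  { apply (flow_on_maximal_interval_trapped gamma_u sigma_p w1 q1 hgamma (proj1 hw1)
      (proj2 hw1) hsub tau U Q HU HF tau _ _ F). lra. }
  destruct (flow_agrees_with_maximal gamma_u sigma_p w1 q1 hgamma (proj1 hw1)
    (proj2 hw1) hsub tau U Q HU HF tau x _ _ F Hd Hx) as [h1 h2]; [lra|].
  cbv beta in h1, h2. rewrite clamp_id in h1, h2 by lra.
  split; [|easy].
  apply (c2_injective gamma_u rho0 p0 sigma_p); try easy; auto.
  rewrite h2. symmetry. apply sound_sq_flow_density; try easy.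
  now apply (flow_pos _ _ _ _ _ _ _ HF).
Qed.
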